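(* Let $G$ be a simple graph of order $n\ge 2$ with adjacency eigenvalues $\lambda_1\ge\cdots\ge\lambda_n$, write $c_k=c_k(G)$, and let $\rho=\lfloor n/2\rfloor$. Then (a) $\displaystyle \frac{c_4}{2\rho}\le\lambda_1^4\le\frac{c_4}{1+(n-1)^{-3}}$; (b) $\displaystyle 8c_4+6(c_2^2-2c_4)^+\le\|G\|_\ast^4$; (c) $\displaystyle \frac{3c_2^2-2c_4}{n(n-1)(n^2+3n-6)}\le\lambda_n^4\le\frac{4c_4-3(2c_4-c_2^2)^+}{8}$; (d) $\displaystyle \beta^4\le\frac{3c_2^2-2c_4}{12\rho^2-4\rho}$, where $$\beta:=\begin{cases}\dfrac{2}{n}\displaystyle\sum_{j=1}^{n/2}\lambda_j & \text{if } n \text{ is even},\\[2mm] \dfrac{2}{n-1}\displaystyle\sum_{j=1}^{(n-1)/2}\lambda_j+\dfrac{2}{n-1}\min\bigl\{0,\lambda_{(n+1)/2}\bigr\} & \text{if } n \text{ is odd}.\end{cases}$$ In particular, if $G$ is bipartite, then (a$'$) $\displaystyle \frac{c_4}{2\rho}\le\lambda_1^4\le\frac{4c_4-3(2c_4-c_2^2)^+}{8}$; (b$'$) $\displaystyle 8c_4+6(c_2^2-2c_4)^+\le\|G\|_\ast^4\le\frac{4\rho^3(3c_2^2-2c_4)}{3\rho-1}$. Moreover, all of these inequalities are sharp, meaning that each of them holds with equality for some graph of order $n$ having at least one edge (bipartite in the case of (a$'$), (b$'$)). They are also best possible among the random vector norms with $d\in\{2,4\}$, in the following sense. Let $\mathcal{N}$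 be the set of all pairs $(X,d)$ with $d\in\{2,4\}$ and $X$ a nonconstant real random variable with $\mathbb{E}|X|^d<\infty$, and let $r,s>0$ be integers with $r+s=n$. Then, with suprema and infima over $(X,d)\in\mathcal{N}$, $$\frac{c_4}{2\rho}=\sup\Bigl(\tfrac{\|G\|_{X,d}}{\|M_n\|_{X,d}}\Bigr)^4,\qquad \frac{3c_2^2-2c_4}{12\rho^2-4\rho}=\inf\Bigl(\tfrac{\|G\|_{X,d}}{\|M_n\|_{X,d}}\Bigr)^4,$$ $$\frac{c_4}{1+(n-1)^{-3}}=\inf\Bigl(\tfrac{(n-1)\|G\|_{X,d}}{\|K_n\|_{X,d}}\Bigr)^4,\qquad \frac{3c_2^2-2c_4}{n(n-1)(n^2+3n-6)}=\sup\Bigl(\tfrac{\|G\|_{X,d}}{\|K_n\|_{X,d}}\Bigr)^4,$$ $$\frac{4c_4-3(2c_4-c_2^2)^+}{8}=\inf\Bigl(\tfrac{\sqrt{rs}\,\|G\|_{X,d}}{\|K_{r,s}\|_{X,d}}\Bigr)^4,\qquad 8c_4+6(c_2^2-2c_4)^+=\sup\Bigl(\tfrac{2\sqrt{rs}\,\|G\|_{X,d}}{\|K_{r,s}\|_{X,d}}\Bigr)^4,$$ and, for the upper bound in (b$'$), $$\frac{4\rho^3(3c_2^2-2c_4)}{3\rho-1}=\inf\Bigl(\tfrac{2\rho\,\|G\|_{X,d}}{\|M_n\|_{X,d}}\Bigr)^4.$$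
   Context: The eigenvalues of a graph are those of its adjacency matrix. $c_k(G)=\lambda_1^k+\cdots+\lambda_n^k$ is the number of closed walks of length $k$ in $G$. The energy of $G$ is $\|G\|_\ast=|\lambda_1|+\cdots+|\lambda_n|$. For real $s$, $s^+=\max\{0,s\}$. For a simple graph $G$ of order $n$ with eigenvalues $\lambda_1,\dots,\lambda_n$, $d\ge 1$ and a nonconstant random variable $X$ with $\mathbb{E}|X|^d<\infty$, the random vector norm is $$\|G\|_{X,d}=\Gamma(d+1)^{-1/d}\bigl(\mathbb{E}|\lambda_1X_1+\cdots+\lambda_nX_n|^d\bigr)^{1/d},$$ where $X_1,\dots,X_n$ are i.i.d. copies of $X$. $K_n$ is the complete graph on $n$ vertices, $K_{r,s}$ the complete bipartite graph with parts of sizes $r,s$, and $M_n$ the matching graph on $n$ vertices: a perfect matching if $n$ is even, and a perfect matching on $n-1$ vertices together with one isolated vertex if $n$ is odd. For every such $X$, every even $d\geq 2$ and all integers $r,s>0$ with $r+s=n$, one has the family of bounds $$\beta\le\frac{\|G\|_{X,d}}{\|M_n\|_{X,d}}\le\lambda_1\le\frac{(n-1)\|G\|_{X,d}}{\|K_n\|_{X,d}},\qquad \frac{\|G\|_{X,d}}{\|K_n\|_{X,d}}\le|\lambda_n|\le\frac{\sqrt{rs}\,\|G\|_{X,d}}{\|K_{r,s}\|_{X,d}}\le\frac{\|G\|_\ast}{2},$$ and ''best possible'' refers to optimizing these bounds over $X$ and $d\in\{2,4\}$ (including limits). *)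

(* Defs.v *)
From HB Require Import structures.
From mathcomp Require Import all_boot all_order all_algebra.
From mathcomp Require Import all_classical all_reals all_analysis.
From mathcomp Require Import complex.

Set Implicit Arguments.
Unset Strict Implicit.
Unset Printing Implicit Defensive.

Import Order.TTheory GRing.Theory Num.Theory.
Import numFieldNormedType.Exports.

Local Open Scope classical_set_scope.
Local Open Scope ring_scope.

Record sgraph (n : nat) := SGraph {
  adj :> rel 'I_n;
  adj_sym : symmetric adj;
  adj_irr : irreflexive adj
}.

Definition has_edge n (G : sgraph n) : Prop := exists i j, adj G i j.

Definition bipartite n (G : sgraph n) : Prop :=
  exists f : 'I_n -> bool, forall i j, adj G i j -> f i != f j.

Lemma complete_sym n : symmetric (fun i j : 'I_n => i != j).
Proof. by move=> i j; rewrite eq_sym. Qed.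

Lemma complete_irr n : irreflexive (fun i j : 'I_n => i != j).
Proof. by move=> i; rewrite eqxx. Qed.

Definition complete_graph n : sgraph n := SGraph (@complete_sym n) (@complete_irr n).

Lemma complete_bipartite_sym r s :
  symmetric (fun i j : 'I_(r + s) => (i < r)%N != (j < r)%N).
Proof. by move=> i j; rewrite eq_sym. Qed.

Lemma complete_bipartite_irr r s :
  irreflexive (fun i j : 'I_(r + s) => (i < r)%N != (j < r)%N).
Proof. by move=> i; rewrite eqxx. Qed.

Definition complete_bipartite r s : sgraph (r + s) :=
  SGraph (@complete_bipartite_sym r s) (@complete_bipartite_irr r s).

Lemma matching_sym n :
  symmetric (fun i j : 'I_n => (i != j) && (i./2 == j./2)).
Proof. by move=> i j; rewrite eq_sym [X in _ && X]eq_sym. Qed.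

Lemma matching_irr n :
  irreflexive (fun i j : 'I_n => (i != j) && (i./2 == j./2)).
Proof. by move=> i; rewrite eqxx. Qed.

(* The edges are {0,1}, {2,3}, ...; when n is odd, the last vertex n-1 is
   isolated. *)
Definition matching_graph n : sgraph n := SGraph (@matching_sym n) (@matching_irr n).

Definition adj_matrix (R : realType) n (G : sgraph n) : 'M[R]_n :=
  \matrix_(i, j) (adj G i j)%:R.

(* The default value [::] is never used, by eigvalsP below. *)
Definition eigvals (R : realType) n (G : sgraph n) : seq R :=
  xget [::] [set s : seq R | sorted >=%R s /\
    char_poly (adj_matrix R G) = \prod_(x <- s) ('X - x%:P)].

Section eigvals_exist.

Lemma char_poly_similar (F : fieldType) n (P D : 'M[F]_n) : P \in unitmx ->
  char_poly (invmx P *m D *m P) = char_poly D.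
Proof.
move=> Pu; set p := map_mx polyC P.
have pu : map_mx polyC (invmx P) *m p = 1%:M.
  by rewrite -map_mxM mulVmx// map_mx1.
have -> : char_poly (invmx P *m D *m P) =
    \det (map_mx polyC (invmx P) *m char_poly_mx D *m p).
  congr (\det _); rewrite /char_poly_mx !map_mxM mulmxBr mulmxBl.
  by rewrite scalar_mxC -['X%:M *m _ *m p]mulmxA pu mulmx1.
by rewrite !det_mulmx mulrAC -det_mulmx pu det1 mul1r.
Qed.

Lemma eigvals_exist (R : realType) n (G : sgraph n) : exists s : seq R,
  sorted >=%R s /\
  char_poly (adj_matrix R G) = \prod_(x <- s) ('X - x%:P).
Proof.
pose f := real_complex R.
pose A : 'M[R[i]%C]_n := map_mx f (adj_matrix R G).
have Ah : A \is hermsymmx.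
  apply/is_hermitianmxP; rewrite expr0 scale1r.
  apply/matrixP => i j; rewrite !mxE adj_sym.
  by case: (G j i) => /=; rewrite ?rmorph1 ?rmorph0.
have /mxOverP sr := hermitian_spectral_diag_real Ah.
have /hermitian_normalmx/orthomx_spectralP AE := Ah.
pose v i := complex.Re (spectral_diag A 0 i).
have vE i : spectral_diag A 0 i = f (v i).
  by have /RRe_real := sr 0 i => <-.
exists (sort >=%R [seq v i | i : 'I_n]); split.
  by apply: sort_sorted => x y; exact: real_leVge (num_real _) (num_real _).
rewrite (perm_big [seq v i | i : 'I_n])/=; last by rewrite perm_sort.
apply: (@map_poly_inj _ _ f).
rewrite map_char_poly -/A [in LHS]AE char_poly_similar ?spectral_unit//.
rewrite char_poly_trig ?diag_mx_is_trig// big_image/= rmorph_prod/=.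
by apply: eq_bigr => i _; rewrite map_polyXsubC !mxE eqxx mulr1n vE.
Qed.

Lemma eigvalsP (R : realType) n (G : sgraph n) :
  sorted >=%R (eigvals R G) /\
  char_poly (adj_matrix R G) = \prod_(x <- eigvals R G) ('X - x%:P).
Proof. exact: (xgetPex [::] (@eigvals_exist R n G)). Qed.

Lemma size_eigvals (R : realType) n (G : sgraph n) : size (eigvals R G) = n.
Proof.
have [_ /(congr1 (fun p : {poly R} => size p))] := eigvalsP R G.
by rewrite size_char_poly size_prod_XsubC => -[].
Qed.

End eigvals_exist.

(* Indexed from 1, as in lambda_1 >= ... >= lambda_n. *)
Definition lambda (R : realType) n (G : sgraph n) (j : nat) : R :=
  (eigvals R G)`_j.-1.

Definition ck (R : realType) (k n : nat) (G : sgraph n) : R :=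
  \sum_(1 <= j < n.+1) lambda R G j ^+ k.

Definition energy (R : realType) n (G : sgraph n) : R :=
  \sum_(1 <= j < n.+1) `|lambda R G j|.

Definition pos_part (R : realType) (s : R) : R := Num.max 0 s.

Definition beta (R : realType) n (G : sgraph n) : R :=
  if odd n then
    2 / (n%:R - 1) * (\sum_(1 <= j < (n.-1)./2.+1) lambda R G j)
    + 2 / (n%:R - 1) * Num.min 0 (lambda R G (n.+1)./2)
  else
    2 / n%:R * \sum_(1 <= j < n./2.+1) lambda R G j.

Definition Gamma (R : realType) (x : R) : R :=
  \int[lebesgue_measure]_(t in `]0, +oo[) (t `^ (x - 1) * expR (- t)).

(* [power_prob P n] is the n-fold product of P: on its sample space of
   n-tuples, the functions w |-> X (tnth w i) are n independent copies of X
   (see power_prob_indep and power_prob_copy). *)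
Section power_prob.
Context d (T : measurableType d) (R : realType) (P : probability T R).

Definition tcons n (x : T * n.-tuple T) : n.+1.-tuple T :=
  [the n.+1.-tuple T of x.1 :: x.2].

Lemma measurable_tcons n : measurable_fun setT (@tcons n).
Proof. exact: measurable_cons. Qed.

HB.instance Definition _ n := isMeasurableFun.Build _ _ _ _
  (@tcons n) (@measurable_tcons n).

Fixpoint power_prob n : probability (n.-tuple T) R :=
  match n with
  | 0 => \d_[tuple]
  | m.+1 => distribution (P \x power_prob m)%E (@tcons m)
  end.

Lemma power_prob_box n (A : 'I_n -> set T) : (forall i, measurable (A i)) ->
  power_prob n [set w | forall i, A i (tnth w i)] = (\prod_i P (A i))%E.
Proof.
elim: n A => [|n IHn] A mA.
  rewrite big_ord0 /= (_ : [set _ | _] = setT) ?diracT//.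
  by apply/seteqP; split => // w _ [].
pose A' i := A (lift ord0 i).
have mA' : measurable [set w : n.-tuple T | forall i, A' i (tnth w i)].
  rewrite (_ : [set _ | _] =
      \bigcap_(i in [set: 'I_n]) ((@tnth n T)^~ i @^-1` A' i)).
    apply: fin_bigcap_measurable => [|i _]; first exact: finite_finset.
    by rewrite -[X in measurable X]setTI; apply: measurable_tnth => //; exact: mA.
  by apply/seteqP; split=> w wA i => [_|]; exact: wA.
rewrite /= /distribution /pushforward.
rewrite (_ : _ @^-1` _ = A ord0 `*` [set w | forall i, A' i (tnth w i)]).
  rewrite product_measure1E// big_ord_recl -(IHn A')// => i; exact: mA.
apply/seteqP; split=> [[x w] /= wA|[x w] /= [xA wA] i].
  split=> [|i]; first by have := wA ord0; rewrite (tnth_nth x).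
  by have := wA (lift ord0 i); rewrite tnthS.
by have [j ->|->] := unliftP ord0 i; [rewrite tnthS; exact: wA|rewrite (tnth_nth x)].
Qed.

Lemma power_prob_indep n (X : {RV P >-> R}) (B : 'I_n -> set R) :
  (forall i, measurable (B i)) ->
  power_prob n [set w | forall i, B i (X (tnth w i))] =
  (\prod_i P (X @^-1` B i))%E.
Proof.
move=> mB; rewrite -(@power_prob_box _ (fun i => X @^-1` B i))// => i.
by rewrite -[X in measurable X]setTI; exact: measurable_funP.
Qed.

Lemma power_prob_copy n (X : {RV P >-> R}) (i : 'I_n) (B : set R) :
  measurable B ->
  power_prob n [set w | B (X (tnth w i))] = P (X @^-1` B).
Proof.
move=> mB; pose C j := if j == i then B else setT.
rewrite (_ : [set _ | _] = [set w | forall j, C j (X (tnth w j))]); last first.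
  apply/seteqP; split=> w wB; last by have := wB i; rewrite /C eqxx.
  by move=> j; rewrite /C; case: eqP => [->|].
rewrite power_prob_indep => [|j]; last by rewrite /C; case: ifP.
rewrite (bigD1 i)//= /C eqxx big1 ?mule1// => j /negPf ->.
by rewrite preimage_setT probability_setT.
Qed.

End power_prob.

Definition rv_norm (d : measure_display) (T : measurableType d) (R : realType)
    (P : probability T R) (X : {RV P >-> R}) (p : R) n (G : sgraph n) : R :=
  Gamma (p + 1) `^ (- p^-1) *
  (fine 'E_(power_prob P n)
    [fun w => `|\sum_(i < n) lambda R G i.+1 * X (tnth w i)| `^ p]) `^ p^-1.

(* "Nonconstant" is meant up to null sets: otherwise all the norms could
   vanish. *)
Definition admissible (d : measure_display) (T : measurableType d)
    (R : realType) (P : probability T R) (X : {RV P >-> R}) (p : R) : Prop :=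
  [/\ p = 2 \/ p = 4,
      ~ (exists a : R, {ae P, forall w, X w = a})
    & ('E_P[(fun w => `|X w| `^ p)%R] < +oo)%E].

(* The values of (a ||G||_{X,p} / ||H||_{X,p})^4, where (X, p) ranges over the
   admissible pairs, on all probability spaces. *)
Definition ratios4 (R : realType) (a : R) n (G : sgraph n) m (H : sgraph m) :
    set \bar R :=
  [set y | exists (d : measure_display) (T : measurableType d)
             (P : probability T R) (X : {RV P >-> R}) (p : R),
     admissible X p /\ y = ((a * rv_norm X p G / rv_norm X p H) ^+ 4)%:E].

Definition attained (R : realType) n (lhs rhs : sgraph n -> R) : Prop :=
  exists G : sgraph n, has_edge G /\ lhs G = rhs G.

Definition attained_bipartite (R : realType) n (lhs rhs : sgraph n -> R) :
    Prop :=
  exists G : sgraph n, [/\ bipartite G, has_edge G & lhs G = rhs G].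

(* Main.v *)
Require Import Defs.
From HB Require Import structures.
From mathcomp Require Import all_boot all_order all_algebra.
From mathcomp Require Import all_classical all_reals all_analysis.
From mathcomp Require Import complex measurable_realfun.
From mathcomp Require Import exponential_distribution bernoulli_distribution.
From mathcomp Require Import zify ring lra.

Set Implicit Arguments.
Unset Strict Implicit.
Unset Printing Implicit Defensive.

Import Order.TTheory GRing.Theory Num.Theory.
Import numFieldNormedType.Exports.

Local Open Scope classical_set_scope.
Local Open Scope ring_scope.

(** Write [c2], [c4] for the power sums of the eigenvalues and
    [F = 3 c2^2 - 2 c4].  The number [F] is the fourth moment of the random
    signed sum of the eigenvalues, so it is a convex function of the vector of
    eigenvalues; its tangent inequality is proved directly by induction on the
    vector ([sign_sum_tangent]).  Each bound on an eigenvalue, on the energy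
    or on [beta] compares a value of one of the convex functions [c4] and [F] at
    two vectors, one of which majorizes the other.  The vector of eigenvalues
    has sum zero because the trace vanishes, and its largest entry has the
    largest absolute value ([ev_norm_le]).  Then [sum4_le_max4] and
    [sum4_ge_entry] bound the largest eigenvalue, [sum_norm_ge] the energy,
    [rad4_le_min4] and [rad4_ge_two] the smallest eigenvalue, and
    [rad4_ge_signed] bounds [beta].  The spectrum of a bipartite graph is
    symmetric about zero ([ev_symmetric]), so that its largest eigenvalue is the
    opposite of the smallest one, and its energy is [2 floor(n/2) beta].

    For the norms, let [Y] be the centered variable, [s] its variance and
    [t + 1 >= 1] its normalized fourth moment.  Since the eigenvalues have sum
    zero, only [Y] matters, and expanding the fourth power of the sum of
    independent copies gives, up to the gamma factor, [s^2 (t c4 + F)]; the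
    case [d = 2] behaves like [t = 2], because [2 c4 + F = 3 c2^2].  So every
    fourth power of a ratio of norms of [G] and [H] is a mediant
    [(t c4(G) + F(G)) / (t c4(H) + F(H))] with [t >= 0].  Bernoulli variables
    realize [t = 0] and arbitrarily large [t], hence the supremum and the
    infimum are the maximum and the minimum of the two quotients
    [c4(G) / c4(H)] and [F(G) / F(H)] ([ereal_sup_ratios4],
    [ereal_inf_ratios4]).

    It remains to compare the two quotients for each [H].  For [K_n] this is
    the sharp upper bound of [c4 / c2^2] for vectors of sum zero
    ([sum4_le_zero_sum]).  For [M_n] it is [c2^2 <= 2 floor(n/2) c4], which is
    the Cauchy-Schwarz inequality when [n] is even.  When [n] is odd it fails
    for some real vectors of sum zero, for instance (3, 3, -2, -2, -2), and it
    is obtained by counting closed walks of length four and using that the sum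
    of the degrees is even ([ck2_sqr_le]).  For the complete bipartite graphs
    both quotients occur, which produces the positive parts.

    Equality is attained at [M_n], at [K_n], and at the graph with a single
    edge, which replaces the complete bipartite graphs as an extremal example:
    the spectra of graphs with maximum degree one are read off from
    [A^3 = A]. *)

(** * Fourth moments of signed sums and zero-sum vectors *)

Section quartic.
Context {R : realFieldType}.

(** Convexity of the fourth power: its graph lies above the tangent at [b]. *)
Lemma quartic_tangent (a b : R) : 4 * b ^+ 3 * a - 3 * b ^+ 4 <= a ^+ 4.
Proof.
rewrite -subr_ge0; have -> : a ^+ 4 - (4 * b ^+ 3 * a - 3 * b ^+ 4) =
  (a - b) ^+ 2 * ((a + b) ^+ 2 + 2 * b ^+ 2) by ring.
by apply: mulr_ge0; [exact: sqr_ge0|have := sqr_ge0 (a + b); have := sqr_ge0 b; lra].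
Qed.

(** Averaging [quartic_tangent] over all signs, at the points
    [a + sum (+-x_i)] and [b + sum (+-y_i)], and expanding the moments in power
    sums gives this inequality.  The shifts [a] and [b] make the averaging an
    induction: one more sign averages the shifts [a +- x_i], [b +- y_i]. *)
Lemma sign_sum_tangent I (r : seq I) (x y : I -> R) (a b : R) :
  4 * (b ^+ 3 * a + 3 * b ^+ 2 * (\sum_(i <- r) x i * y i) +
       3 * a * b * (\sum_(i <- r) y i ^+ 2) +
       3 * (\sum_(i <- r) y i ^+ 2) * (\sum_(i <- r) x i * y i) -
       2 * (\sum_(i <- r) x i * y i ^+ 3)) <=
  (a ^+ 4 + 6 * a ^+ 2 * (\sum_(i <- r) x i ^+ 2) +
   3 * (\sum_(i <- r) x i ^+ 2) ^+ 2 - 2 * (\sum_(i <- r) x i ^+ 4)) +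
  3 * (b ^+ 4 + 6 * b ^+ 2 * (\sum_(i <- r) y i ^+ 2) +
   3 * (\sum_(i <- r) y i ^+ 2) ^+ 2 - 2 * (\sum_(i <- r) y i ^+ 4)).
Proof.
elim: r a b => [|i r IH] a b.
  by rewrite !big_nil; have := quartic_tangent a b; lra.
rewrite !big_cons; have := IH (a + x i) (b + y i); have := IH (a - x i) (b - y i).
move: (x i) (y i) (\sum_(j <- r) x j * y j) (\sum_(j <- r) y j ^+ 2)
  (\sum_(j <- r) x j * y j ^+ 3) (\sum_(j <- r) x j ^+ 2)
  (\sum_(j <- r) x j ^+ 4) (\sum_(j <- r) y j ^+ 4) => u v s1 s2 s3 s4 s5 s6.
move=> h1 h2.
lra.
Qed.

(** The fourth moment of the sum of the [x i] with independent uniform signs. *)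
Definition rad4 n (x : 'I_n -> R) : R :=
  3 * (\sum_i x i ^+ 2) ^+ 2 - 2 * \sum_i x i ^+ 4.

(** The left-hand side is the scalar product of [x] with the gradient of [rad4]
    at [y]; for [x = y] it is [4 * rad4 y], as [rad4] is a quartic form. *)
Lemma rad4_tangent n (x y : 'I_n -> R) :
  12 * (\sum_i y i ^+ 2) * (\sum_i x i * y i) - 8 * (\sum_i x i * y i ^+ 3) <=
  rad4 x + 3 * rad4 y.
Proof. by have := sign_sum_tangent (index_enum 'I_n) x y 0 0; rewrite /rad4; lra. Qed.

(** The positive and the nonpositive entries have opposite sums, so the sum of
    absolute values is twice a sum over whichever group is the smaller one. *)
Lemma sum_norm_le n (x : 'I_n -> R) (m : R) :
  \sum_i x i = 0 -> (forall i, `|x i| <= m) ->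
  \sum_i `|x i| <= 2 * (n./2)%:R * m.
Proof.
move=> x0 xm.
have [n_eq0|n0] := posnP n; first by subst n; rewrite big_ord0 mulr0 mul0r.
have m0 : 0 <= m by apply: le_trans (xm (Ordinal n0)); exact: normr_ge0.
pose p := #|[pred i | 0 < x i]|; pose q := #|[predC [pred i | 0 < x i]]|.
have pq : (p + q)%N = n by rewrite cardC card_ord.
pose P := \sum_(i | 0 < x i) x i; pose Q := \sum_(i | ~~ (0 < x i)) x i.
have PQ : P + Q = 0 by rewrite -x0 [RHS](bigID (fun i => 0 < x i)).
have EP : \sum_i `|x i| = P - Q.
  rewrite (bigID (fun i => 0 < x i))/= -sumrN; congr (_ + _).
    by apply: eq_bigr => i /gtr0_norm.
  by apply: eq_bigr => i; rewrite -leNgt => /ler0_norm.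
have Pp : P <= p%:R * m.
  rewrite mulr_natl -sumr_const; apply: ler_sum => i _.
  exact: le_trans (ler_norm _) (xm i).
have Qq : - Q <= q%:R * m.
  rewrite mulr_natl -sumr_const -sumrN; apply: ler_sum => i _.
  by apply: le_trans (ler_norm _) _; rewrite normrN.
have [ph|ph] := leqP p n./2.
  have : p%:R * m <= (n./2)%:R * m by rewrite ler_wpM2r// ler_nat.
  by rewrite EP; lra.
have qh : (q <= n./2)%N.
  have := odd_double_half n; move: ph pq; rewrite -addnn; lia.
have : q%:R * m <= (n./2)%:R * m by rewrite ler_wpM2r// ler_nat.
by rewrite EP; lra.
Qed.

Lemma sum4_le_max4 n (x : 'I_n -> R) (m : R) :
  \sum_i x i = 0 -> (forall i, `|x i| <= m) ->
  \sum_i x i ^+ 4 <= 2 * (n./2)%:R * m ^+ 4.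
Proof.
move=> x0 xm; have := sum_norm_le x0 xm.
have [n_eq0|n0] := posnP n; first by subst n; rewrite !big_ord0 mulr0 !mul0r.
have m0 : 0 <= m by apply: le_trans (xm (Ordinal n0)); exact: normr_ge0.
move=> /(ler_wpM2l (exprn_ge0 3 m0)) h; apply: le_trans (le_trans _ h) _; last first.
  by rewrite [leRHS](_ : _ = m ^+ 3 * (2 * (n./2)%:R * m)) //; ring.
rewrite mulr_sumr; apply: ler_sum => i _.
rewrite -(@ger0_norm _ (x i ^+ 4)) ?exprn_even_ge0// normrX exprSr.
by rewrite ler_wpM2r// lerXn2r// nnegrE.
Qed.

(** The other entries have sum [- x k]; the fourth powers are smallest when
    these entries are equal, by the tangent at their mean. *)
Lemma sum4_ge_entry n (x : 'I_n -> R) (k : 'I_n) : (1 < n)%N ->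
  \sum_i x i = 0 ->
  x k ^+ 4 * (1 + (n%:R - 1) ^- 3) <= \sum_i x i ^+ 4.
Proof.
move=> n1 x0; set N : R := n%:R - 1.
have N0 : 0 < N by rewrite subr_gt0 ltr1n.
pose c := - x k / N.
have xk : \sum_(i | i != k) x i = - x k.
  by apply/eqP; rewrite -addr_eq0 addrC; rewrite (bigD1 k)//= in x0; rewrite x0.
have card : (\sum_(i < n | i != k) (1 : R)) = N.
  rewrite sumr_const /N cardC1 card_ord -subn1 natrB//.
  by apply: leq_trans n1.
have h : \sum_(i | i != k) (4 * c ^+ 3 * x i - 3 * c ^+ 4 * 1) <=
    \sum_(i | i != k) x i ^+ 4.
  by apply: ler_sum => i _; rewrite mulr1; exact: quartic_tangent.
rewrite (bigD1 k)//= mulrDr mulr1 lerD2l; apply: le_trans h.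
rewrite sumrB -!mulr_sumr xk card le_eqVlt; apply/orP; left; apply/eqP.
by rewrite /c; field; rewrite gt_eqF.
Qed.

(** All the monomials in the expansion of [S 1 ^+ 4] are nonnegative, and those
    with even exponents add up to [3 * S 2 ^+ 2 - 2 * S 4]. *)
Lemma ge0_sum_powers I (r : seq I) (x : I -> R) : (forall i, 0 <= x i) ->
  let S k := \sum_(i <- r) x i ^+ k in
  [/\ S 2 <= S 1 ^+ 2, S 4 <= S 1 ^+ 4 & 3 * S 2 ^+ 2 - 2 * S 4 <= S 1 ^+ 4].
Proof.
move=> x0; cbv zeta.
have S0 k s : 0 <= \sum_(i <- s) x i ^+ k.
  by apply: sumr_ge0 => i _; exact: exprn_ge0.
elim: r => [|i r [h2 h4 h]]; first by rewrite !big_nil; split; lra.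
rewrite !big_cons !expr1; have := S0 1%N r; have := S0 2%N r; have := x0 i.
move: h2 h4 h; rewrite (eq_bigr _ (fun j _ => expr1 (x j))).
move: (x i) (\sum_(j <- r) x j) (\sum_(j <- r) x j ^+ 2) (\sum_(j <- r) x j ^+ 4).
move=> u s s2 s4 h2 h4 h u0 s20 s0; split.
- by nra.
- have -> : (u + s) ^+ 4 = u ^+ 4 + s ^+ 4 + (4 * (u ^+ 3 * s) + 6 * (u ^+ 2 * s ^+ 2)
    + 4 * (u * s ^+ 3)) by ring.
  have := mulr_ge0 (exprn_ge0 3 u0) s0.
  have := mulr_ge0 (exprn_ge0 2 u0) (exprn_ge0 2 s0).
  by have := mulr_ge0 u0 (exprn_ge0 3 s0); lra.
- have -> : (u + s) ^+ 4 = u ^+ 4 + s ^+ 4 + (4 * (u ^+ 3 * s) + 6 * (u ^+ 2 * s ^+ 2)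
    + 4 * (u * s ^+ 3)) by ring.
  have := mulr_ge0 (exprn_ge0 3 u0) s0.
  have := ler_wpM2l (exprn_ge0 2 u0) h2.
  by have := mulr_ge0 u0 (exprn_ge0 3 s0); lra.
Qed.

(** Both bounds compare [x] with the vector having the two nonzero entries
    [E/2] and [-E/2], for [E] the sum of absolute values: the positive and
    the negative parts have the same sum [E/2], and [ge0_sum_powers] applies to
    each of them. *)
Lemma sum_norm_ge n (x : 'I_n -> R) : \sum_i x i = 0 ->
  8 * (\sum_i x i ^+ 4) <= (\sum_i `|x i|) ^+ 4 /\
  2 * rad4 x <= (\sum_i `|x i|) ^+ 4.
Proof.
move=> x0.
pose p i := (`|x i| + x i) / 2; pose q i := (`|x i| - x i) / 2.
have p0 i : 0 <= p i by rewrite /p; have := ler_norm (- x i); rewrite normrN; lra.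
have q0 i : 0 <= q i by rewrite /q; have := ler_norm (x i); lra.
have xx i : `|x i| ^+ 2 = x i ^+ 2 by exact: real_normK (num_real _).
have x2 i : x i ^+ 2 = p i ^+ 2 + q i ^+ 2.
  by have := xx i; rewrite /p /q; lra.
have x4 i : x i ^+ 4 = p i ^+ 4 + q i ^+ 4.
  have -> : p i ^+ 4 + q i ^+ 4 = ((`|x i| ^+ 2) ^+ 2 + 6 * `|x i| ^+ 2 * x i ^+ 2 + x i ^+ 4) / 8.
    by rewrite /p /q; lra.
  by rewrite xx; lra.
have [p2 p4 pf] := ge0_sum_powers (index_enum 'I_n) p0.
have [q2 q4 qf] := ge0_sum_powers (index_enum 'I_n) q0.
have Ep : \sum_i p i ^+ 1 = (\sum_i `|x i|) / 2.
  rewrite (eq_bigr _ (fun j _ => expr1 (p j))).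
  by rewrite /p -mulr_suml big_split/= x0 addr0.
have Eq : \sum_i q i ^+ 1 = (\sum_i `|x i|) / 2.
  rewrite (eq_bigr _ (fun j _ => expr1 (q j))).
  by rewrite /q -mulr_suml sumrB x0 subr0.
rewrite Ep in p2 p4 pf; rewrite Eq in q2 q4 qf.
rewrite /rad4 (eq_bigr _ (fun i _ => x2 i)) (eq_bigr _ (fun i _ => x4 i)).
rewrite !big_split/=.
have P2 : 0 <= \sum_i p i ^+ 2 by apply: sumr_ge0 => i _; exact: sqr_ge0.
have Q2 : 0 <= \sum_i q i ^+ 2 by apply: sumr_ge0 => i _; exact: sqr_ge0.
have := ler_pM P2 Q2 p2 q2.
move: p2 p4 pf q2 q4 qf.
by move: (\sum_i p i ^+ 2) (\sum_i p i ^+ 4) (\sum_i q i ^+ 2) (\sum_i q i ^+ 4)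
  (\sum_i `|x i|) => *; split; lra.
Qed.

(** [rad4] is the sum of the [x k ^+ 4] and of three times the products
    [x k ^+ 2 * x l ^+ 2] with [k != l], so deleting entries decreases it. *)
Lemma rad4_ge_two n (x : 'I_n -> R) (i j : 'I_n) (m : R) : i != j -> 0 <= m ->
  m <= `|x i| -> m <= `|x j| -> 8 * m ^+ 4 <= rad4 x.
Proof.
move=> ij m0 mi mj.
pose u k := x k ^+ 2; have u0 k : 0 <= u k by exact: sqr_ge0.
have mu k : m <= `|x k| -> m ^+ 2 <= u k.
  by move=> mk; rewrite /u -[x k ^+ 2]real_normK ?num_real// lerXn2r// nnegrE.
pose r := [seq k <- index_enum 'I_n | (k != i) && (k != j)].
have [U2 _ _] := ge0_sum_powers r u0.
rewrite (eq_bigr _ (fun j _ => expr1 (u j))) in U2.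
have xu k : x k ^+ 4 = u k ^+ 2 by rewrite /u -exprM.
rewrite /rad4 (eq_bigr _ (fun i _ => xu i)) -/u.
rewrite (bigD1 i)//= (bigD1 j)/=; last by rewrite eq_sym.
rewrite [X in _ - 2 * X](bigD1 i)//= [X in _ - 2 * (_ + X)](bigD1 j)/=; last by rewrite eq_sym.
rewrite -!(big_filter (index_enum _)) -/r -/(u i) -/(u j).
have : 0 <= \sum_(k <- r) u k by apply: sumr_ge0.
move: U2 (mu _ mi) (mu _ mj).
rewrite (_ : m ^+ 4 = (m ^+ 2) ^+ 2); last by rewrite -exprM.
have := sqr_ge0 m.
rewrite -[\sum_(k <- r) x k ^+ 2]/(\sum_(k <- r) u k).
move: (m ^+ 2) (u i) (u j) (\sum_(k <- r) u k) (\sum_(k <- r) u k ^+ 2).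
move=> M a b s s2 M0 h2 aM bM s0.
have := mulr_ge0 (le_trans M0 aM) s0; have := mulr_ge0 (le_trans M0 bM) s0.
have := ler_pM M0 M0 aM bM; have := ler_pM M0 M0 aM aM; have := ler_pM M0 M0 bM bM.
by have := sqr_ge0 s; lra.
Qed.

(** Such vectors are convex combinations of the multiples by [m] of the vectors
    [(n - 1, -1, ..., -1)] and their permutations, the spectra of [K_n]; the
    bound is Jensen's inequality for the convex function [rad4]. *)
Lemma rad4_le_min4 n (x : 'I_n -> R) (m : R) : (1 < n)%N -> 0 <= m ->
  \sum_i x i = 0 -> (forall i, - m <= x i) ->
  rad4 x <= n%:R * (n%:R - 1) * (n%:R ^+ 2 + 3 * n%:R - 6) * m ^+ 4.
Proof.
move=> n1 m0 x0 xm.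
have [m_eq0|m_neq0] := eqVneq m 0.
  have xE i : x i = 0.
    have xi k : 0 <= x k by have := xm k; rewrite m_eq0 oppr0.
    have /eqP := x0; rewrite psumr_eq0// => /allP/(_ i).
    by rewrite mem_index_enum => /(_ isT)/eqP.
  rewrite /rad4 m_eq0 expr0n/= mulr0.
  by rewrite !big1 ?expr0n/= ?mulr0 ?subr0// => i _; rewrite xE expr0n.
have {m_neq0}m0 : 0 < m by rewrite lt_neqAle eq_sym m_neq0.
set N : R := n%:R; have N1 : 1 < N by rewrite ltr1n.
(* The vertices of the simplex containing x. *)
pose v (k i : 'I_n) : R := m * (N * (i == k)%:R - 1).
have d1 (f : 'I_n -> R) k : \sum_i f i * (i == k)%:R = f k.
  rewrite (bigD1 k)//= eqxx mulr1 big1 ?addr0// => i /negPf ->.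
  by rewrite mulr0.
have s1 : \sum_(i < n) (1 : R) = N by rewrite sumr_const card_ord.
have b2 (i k : 'I_n) : ((i == k)%:R : R) ^+ 2 = (i == k)%:R by case: eqP; rewrite ?expr1n ?expr0n.
have v2 k : \sum_i v k i ^+ 2 = m ^+ 2 * (N ^+ 2 - N).
  have vE i : v k i ^+ 2 = m ^+ 2 * (N ^+ 2 - 2 * N) * (i == k)%:R + m ^+ 2 * 1.
    rewrite /v; have := b2 i k; move: (_%:R) => b bb.
    have -> : (m * (N * b - 1)) ^+ 2 = m ^+ 2 * (N ^+ 2 * b ^+ 2 - 2 * N * b + 1) by ring.
    by rewrite bb; ring.
  rewrite (eq_bigr _ (fun i _ => vE i)) big_split/= (d1 (fun=> _)).
  by rewrite -mulr_sumr s1; ring.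
have v4 k : \sum_i v k i ^+ 4 = m ^+ 4 * ((N - 1) ^+ 4 + (N - 1)).
  have vE i : v k i ^+ 4 = m ^+ 4 * ((N - 1) ^+ 4 - 1) * (i == k)%:R + m ^+ 4 * 1.
    by rewrite /v; case: (i == k) => /=; ring.
  rewrite (eq_bigr _ (fun i _ => vE i)) big_split/= (d1 (fun=> _)).
  by rewrite -mulr_sumr s1; ring.
pose F := N * (N - 1) * (N ^+ 2 + 3 * N - 6) * m ^+ 4.
have Fv k : rad4 (v k) = F by rewrite /rad4 v2 v4 /F; ring.
have vx k : \sum_i v k i * x i = m * N * x k.
  rewrite -(d1 (fun i => m * N * x i)).
  transitivity (\sum_i m * N * x i * (i == k)%:R - m * \sum_i x i).
    rewrite mulr_sumr -sumrB; apply: eq_bigr => i _; rewrite /v; ring.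
  by rewrite x0 mulr0 subr0.
have vx3 k : \sum_i v k i * x i ^+ 3 = m * N * x k ^+ 3 - m * \sum_i x i ^+ 3.
  rewrite -(d1 (fun i => m * N * x i ^+ 3)) mulr_sumr -sumrB.
  by apply: eq_bigr => i _; rewrite /v; ring.
pose X2 := \sum_i x i ^+ 2; pose X3 := \sum_i x i ^+ 3; pose X4 := \sum_i x i ^+ 4.
(* The weight of v k in the decomposition of x is (x k + m) / (n m). *)
have T k : 0 <= (x k + m) * (F + 3 * rad4 x -
    12 * X2 * (m * N * x k) + 8 * (m * N * x k ^+ 3 - m * X3)).
  apply: mulr_ge0; first by have := xm k; lra.
  by have := rad4_tangent (v k) x; rewrite Fv vx vx3 -/X2 -/X3; lra.
have : 0 <= \sum_k (x k + m) * (F + 3 * rad4 x -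
    12 * X2 * (m * N * x k) + 8 * (m * N * x k ^+ 3 - m * X3)) by apply: sumr_ge0.
rewrite (_ : \sum_k _ = m * N * (F - rad4 x)).
  by rewrite pmulr_rge0 ?subr_ge0// mulr_gt0//; lra.
rewrite (eq_bigr (fun k => (F + 3 * rad4 x - 8 * m * X3 - 12 * X2 * m ^+ 2 * N) * x k
  + m * (F + 3 * rad4 x - 8 * m * X3) * 1 - 12 * X2 * m * N * x k ^+ 2
  + 8 * m * N * x k ^+ 4 + 8 * m ^+ 2 * N * x k ^+ 3)); last by move=> k _; ring.
rewrite !big_split/= sumrN -!mulr_sumr x0 s1 -/X2 -/X3 -/X4.
by rewrite /rad4 -/X2 -/X4; ring.
Qed.

(** The tangent inequality at [b * e], a point at which the gradient of [rad4]
    is a nonnegative multiple of [e]. *)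
Lemma rad4_ge_signed n (x e : 'I_n -> R) (N b : R) : 1 <= N -> 0 <= b ->
  (forall i, e i ^+ 3 = e i) -> \sum_i e i ^+ 2 = N ->
  N * b <= \sum_i e i * x i -> (3 * N ^+ 2 - 2 * N) * b ^+ 4 <= rad4 x.
Proof.
move=> N1 b0 e3 eN h.
have e4 i : e i ^+ 4 = e i ^+ 2 by rewrite exprS e3 -expr2.
have := rad4_tangent x (fun i => b * e i).
have -> : rad4 (fun i => b * e i) = (3 * N ^+ 2 - 2 * N) * b ^+ 4.
  rewrite /rad4; under eq_bigr do rewrite exprMn; rewrite -mulr_sumr eN.
  under eq_bigr do rewrite exprMn e4.
  by rewrite -mulr_sumr eN; ring.
have -> : \sum_i (b * e i) ^+ 2 = b ^+ 2 * N.
  by under eq_bigr do rewrite exprMn; rewrite -mulr_sumr eN.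
have -> : \sum_i x i * (b * e i) = b * \sum_i e i * x i.
  by rewrite mulr_sumr; apply: eq_bigr => i _; ring.
have -> : \sum_i x i * (b * e i) ^+ 3 = b ^+ 3 * \sum_i e i * x i.
  by rewrite mulr_sumr; apply: eq_bigr => i _; rewrite exprMn e3; ring.
have c0 : 0 <= b ^+ 3 * (12 * N - 8) by rewrite mulr_ge0 ?exprn_ge0//; lra.
by have := ler_wpM2l c0 h; lra.
Qed.

(** The kurtosis of [n] real numbers is largest when all but one of them are
    equal.  Induction on the number of entries: one entry [M] is split off and
    the others are centered, so that they are [z - c] with [z] of sum zero.
    The cross term with the cubes of [z] is absorbed by
    [sum (z^2 + d c z - Z2 / m)^2 >= 0]; the choice [d = (m + 1) (m - 2)] makes
    the remaining terms add up exactly. *)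
Lemma sum4_le_zero_sum (s : seq R) : \sum_(x <- s) x = 0 ->
  let n : R := (size s)%:R in
  n * (n - 1) * (\sum_(x <- s) x ^+ 4) <=
  (n ^+ 2 - 3 * n + 3) * (\sum_(x <- s) x ^+ 2) ^+ 2.
Proof.
move: {2}(size s) (erefl (size s)) => k; elim: k s => [|k IH] s.
  by move=> /size0nil ->; rewrite !big_nil => _ /=; lra.
case: s => // M t [tk]; rewrite !big_cons => Mt; cbv zeta.
have [k3|k3] := leqP k 2%N.
  move: k3 tk Mt; case: t => [|a [|b [|e t]]] /= k3 tk; rewrite ?big_cons ?big_nil.
  - by rewrite !addr0 => ->; rewrite !expr0n/=; lra.
  - by rewrite !addr0 => /eqP; rewrite addr_eq0 => /eqP ->; lra.
  - rewrite !addr0 => /eqP; rewrite addr_eq0 => /eqP ->.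
    by rewrite le_eqVlt; apply/orP; left; apply/eqP; ring.
  - by move: k3; rewrite -tk.
pose m : R := k%:R.
have m3 : 3 <= m by rewrite /m (ler_nat _ 3).
(* The mean of the entries of t is - c. *)
pose c := M / m.
have Mc : M = m * c by rewrite /c mulrC divfK// gt_eqF//; lra.
pose z := [seq y + c | y <- t].
have St : \sum_(y <- t) 1 = m :> R.
  by rewrite big_const_seq count_predT iter_addr_0 tk.
have z1 : \sum_(y <- z) y = 0.
  by rewrite big_map big_split/= -(mul1r c) -mulr_suml St -Mc addrC.
have zk : size z = k by rewrite size_map.
have := IH z zk z1; rewrite zk /= -/m.
pose Z2 := \sum_(y <- z) y ^+ 2; pose Z3 := \sum_(y <- z) y ^+ 3.
pose Z4 := \sum_(y <- z) y ^+ 4; rewrite -/Z2 -/Z4 => ih.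
have Sz : \sum_(y <- z) 1 = m :> R by rewrite big_map.
have T2 : \sum_(y <- t) y ^+ 2 = Z2 + m * c ^+ 2.
  transitivity (\sum_(y <- z) (y - c) ^+ 2).
    by rewrite big_map; apply: eq_bigr => y _; rewrite addrK.
  rewrite (eq_bigr (fun y => y ^+ 2 - 2 * c * y + c ^+ 2 * 1)); last by move=> y _; ring.
  by rewrite !big_split/= sumrN -!mulr_sumr z1 Sz -/Z2; ring.
have T4 : \sum_(y <- t) y ^+ 4 = Z4 - 4 * c * Z3 + 6 * c ^+ 2 * Z2 + m * c ^+ 4.
  transitivity (\sum_(y <- z) (y - c) ^+ 4).
    by rewrite big_map; apply: eq_bigr => y _; rewrite addrK.
  rewrite (eq_bigr (fun y => y ^+ 4 - 4 * c * y ^+ 3 + 6 * c ^+ 2 * y ^+ 2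
    - 4 * c ^+ 3 * y + c ^+ 4 * 1)); last by move=> y _; ring.
  by rewrite !big_split/= !sumrN -!mulr_sumr z1 Sz -/Z2 -/Z3 -/Z4; ring.
pose d := (m + 1) * (m - 2).
have d0 : 0 < d by rewrite mulr_gt0//; lra.
have Q0 : 0 <= m * Z4 - Z2 ^+ 2 + m * (2 * d * c * Z3 + d ^+ 2 * c ^+ 2 * Z2).
  have : 0 <= \sum_(y <- z) (y ^+ 2 + d * c * y - Z2 / m) ^+ 2.
    by apply: sumr_ge0 => y _; exact: sqr_ge0.
  rewrite (eq_bigr (fun y => y ^+ 4 + 2 * d * c * y ^+ 3 + d ^+ 2 * c ^+ 2 * y ^+ 2
    - 2 * (Z2 / m) * y ^+ 2 - 2 * d * c * (Z2 / m) * y + (Z2 / m) ^+ 2 * 1));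
    last by move=> y _; ring.
  rewrite !big_split/= !sumrN -!mulr_sumr z1 Sz -/Z2 -/Z3 -/Z4.
  rewrite -(@pmulr_rge0 _ m); last by lra.
  by congr (0 <= _); field; rewrite gt_eqF//; lra.
rewrite tk -[k.+1]addn1 natrD -/m T2 T4 Mc -subr_ge0 -(@pmulr_rge0 _ d)//.
rewrite (_ : d * _ = 2 * (m + 1) * (m * Z4 - Z2 ^+ 2 + m * (2 * d * c * Z3 + d ^+ 2 * c ^+ 2 * Z2))
  + (m + 1) * m * ((m ^+ 2 - 3 * m + 3) * Z2 ^+ 2 - m * (m - 1) * Z4)); last first.
  by rewrite /d; ring.
by rewrite addr_ge0// mulr_ge0 ?subr_ge0//; nra.
Qed.

Lemma sqr_sum_le (I : finType) (P : pred I) (u : I -> R) :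
  (\sum_(i | P i) u i) ^+ 2 <= #|P|%:R * \sum_(i | P i) u i ^+ 2.
Proof.
have [P0|P0] := posnP #|P|.
  by rewrite P0 big_pred0 ?expr0n ?mul0r//; exact/card0_eq.
pose N : R := #|P|%:R; have N0 : 0 < N by rewrite ltr0n.
pose s := \sum_(i | P i) u i.
have : 0 <= \sum_(i | P i) (u i - s / N) ^+ 2.
  by apply: sumr_ge0 => i _; exact: sqr_ge0.
rewrite (eq_bigr (fun i => u i ^+ 2 - 2 * (s / N) * u i + (s / N) ^+ 2 * 1)); last first.
  by move=> i _; ring.
rewrite !big_split/= sumrN -!mulr_sumr -/s sumr_const -/N.
rewrite -(@pmulr_rge0 _ N)// => h; rewrite -subr_ge0; apply: le_trans h _.
by rewrite -/N le_eqVlt; apply/orP; left; apply/eqP; field; rewrite gt_eqF.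
Qed.

(** If some [d i] vanishes this is the Cauchy-Schwarz inequality for the other
    [n - 1] terms, since [d i <= d i ^ 2].  Otherwise the excesses [d i - 1]
    have a positive sum [s], because the parities of [n] and of the sum of
    the [d i] differ, and integrality decides the cases of small [s]. *)
Lemma sqr_sum_degrees_le n (d : 'I_n -> nat) : (2 < n)%N -> odd n ->
  ~~ odd (\sum_i d i)%N ->
  (\sum_i (d i)%:R) ^+ 2 <=
    (n%:R - 1) * (2 * (\sum_i (d i)%:R ^+ 2) - \sum_i (d i)%:R) :> R.
Proof.
move=> n2 on ed; set D : R := \sum_i _; set Q : R := \sum_i _ ^+ 2.
pose N : R := n%:R.
have n3 : 3 <= N by rewrite (ler_nat _ 3).
have QD : D <= Q.
  by apply: ler_sum => i _; rewrite -natrX ler_nat;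
    case: (d i) => // k; rewrite expnS expn1 leq_pmulr.
have [/existsP[i /eqP di]|/existsPn H] := boolP [exists i, d i == 0%N].
  have h : D ^+ 2 <= (N - 1) * Q.
    rewrite /D /Q (bigD1 i)//= [X in _ <= _ * X](bigD1 i)//= di expr0n !add0r.
    apply: le_trans (sqr_sum_le _ _) _.
    by rewrite cardC1 card_ord -subn1 natrB//; apply: leq_trans n2.
  by apply: le_trans h _; rewrite ler_wpM2l//; lra.
pose e i := (d i).-1; have de i : d i = (e i).+1 by rewrite /e prednK// lt0n.
pose S := (\sum_i e i)%N.
have dS : (\sum_i d i)%N = (n + S)%N.
  rewrite (eq_bigr _ (fun i _ => de i)) -(eq_bigr _ (fun i _ => add1n (e i))).
  by rewrite big_split/= sum1_card card_ord.
have S0 : (0 < S)%N.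
  by rewrite lt0n; apply: contraNneq ed => S0; rewrite dS S0 addn0.
pose s : R := S%:R; pose E2 : R := \sum_i (e i)%:R ^+ 2.
have Ds : D = N + s by rewrite /D -natr_sum dS natrD.
have dE i : (d i)%:R = (e i)%:R + 1 :> R by rewrite de natr1.
have sE : \sum_i (e i)%:R = s :> R by rewrite -natr_sum.
have QE : Q = E2 + 2 * s + N.
  rewrite /Q (eq_bigr (fun i => (e i)%:R ^+ 2 + 2 * (e i)%:R + 1)); last first.
    by move=> i _; rewrite dE; ring.
  by rewrite !big_split/= -mulr_sumr sE sumr_const card_ord.
have sE2 : s <= E2.
  by rewrite -sE; apply: ler_sum => i _; rewrite -natrX ler_nat;
    case: (e i) => // k; rewrite expnS expn1 leq_pmulr.
have NE2 : s ^+ 2 <= N * E2.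
  by have := sqr_sum_le predT (fun i => (e i)%:R); rewrite sE card_ord.
rewrite QE Ds -subr_ge0.
rewrite (_ : _ - _ = (N - 3) * s - N + 2 * (N - 1) * E2 - s ^+ 2); last by ring.
have [S2|S3] := leqP S 2%N; last first.
  have s3 : 3 <= s by rewrite (ler_nat _ 3).
  have : 0 <= (N - 2) * (E2 - s) by rewrite mulr_ge0//; lra.
  have : 0 <= (N - 3) * (s - 3) by rewrite mulr_ge0//; lra.
  have : 0 <= s * (s - 3) by rewrite mulr_ge0//; lra.
  lra.
have [s1|s2] : s = 1 \/ s = 2.
  rewrite /s; have [->|->] : S = 1%N \/ S = 2%N by lia.
    by left.
  by right.
- rewrite s1 in sE2 *.
  have : 0 <= (N - 3) * (E2 - 1) by rewrite mulr_ge0//; lra.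
  lra.
- rewrite s2 in sE2 *.
  have : 0 <= (N - 3) * (E2 - 2) by rewrite mulr_ge0//; lra.
  lra.
Qed.

(** The middle term is a weighted mean of the outer quotients, with weights
    [t * a] and [b]. *)
Lemma mediant_between (x y a b t : R) : 0 <= t -> 0 < a -> 0 < b ->
  Num.min (x / a) (y / b) <= (t * x + y) / (t * a + b) <= Num.max (x / a) (y / b).
Proof.
move=> t0 a0 b0; have ab : 0 < t * a + b by rewrite ltr_wpDl// mulr_ge0// ltW.
set u := x / a; set v := y / b.
have -> : x = u * a by rewrite divfK// gt_eqF.
have -> : y = v * b by rewrite divfK// gt_eqF.
rewrite ler_pdivlMr// ler_pdivrMr//.
have ta0 : 0 <= t * a by rewrite mulr_ge0// ltW.
have [m1 m2] : Num.min u v <= u /\ Num.min u v <= v by rewrite !ge_min !lexx orbT.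
have [M1 M2] : u <= Num.max u v /\ v <= Num.max u v by rewrite !le_max !lexx orbT.
have := ler_wpM2r ta0 m1; have := ler_wpM2r (ltW b0) m2.
have := ler_wpM2r ta0 M1; have := ler_wpM2r (ltW b0) M2.
by move=> *; apply/andP; split; lra.
Qed.

End quartic.

(** * The spectrum of a graph *)

Section spectrum.
Context {R : realType} {n : nat} (G : sgraph n).

Local Notation A := (adj_matrix R G).

(** The eigenvalues indexed from zero, to be used with sums over ordinals. *)
Definition ev (i : 'I_n) : R := lambda R G i.+1.

Lemma ckE k : ck R k G = \sum_i ev i ^+ k.
Proof. by rewrite /ck big_add1/= big_mkord. Qed.

Lemma energyE : energy R G = \sum_i `|ev i|.
Proof. by rewrite /energy big_add1/= big_mkord. Qed.

Lemma ev_nonincreasing (i j : 'I_n) : (i <= j)%N -> ev j <= ev i.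
Proof.
move=> ij; have [s _] := eigvalsP R G.
have tr : transitive (>=%R : rel R) by move=> a b c ba cb; exact: le_trans cb ba.
have rf : reflexive (>=%R : rel R) by move=> a; exact: lexx.
by apply: (sorted_leq_nth tr rf 0 s); rewrite ?inE ?size_eigvals /=; (exact: ltn_ord || exact: ij).
Qed.

Lemma char_poly_diag_similar (F : fieldType) (P : 'M[F]_n) (v : 'I_n -> F) :
  P \in unitmx ->
  char_poly (invmx P *m diag_mx (\row_i v i) *m P) = \prod_i ('X - (v i)%:P).
Proof.
move=> Pu; rewrite char_poly_similar// char_poly_trig ?diag_mx_is_trig//.
by apply: eq_bigr => i _; rewrite !mxE eqxx mulr1n.
Qed.

(** The spectral theorem for the adjacency matrix seen as a complex Hermitian
    matrix.  The diagonal entries are real, and they form a permutation of the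
    eigenvalues because both lists factor the characteristic polynomial. *)
Lemma diagonalization : exists (P : 'M[R[i]%C]_n) (v : 'I_n -> R),
  [/\ P \in unitmx, perm_eq [seq v i | i : 'I_n] (eigvals R G) &
    map_mx (real_complex R) A =
      invmx P *m diag_mx (\row_i (real_complex R (v i))) *m P].
Proof.
pose f := real_complex R; pose B : 'M[R[i]%C]_n := map_mx f A.
have Bh : B \is hermsymmx.
  apply/is_hermitianmxP; rewrite expr0 scale1r.
  apply/matrixP => i j; rewrite !mxE adj_sym.
  by case: (G j i) => /=; rewrite ?rmorph1 ?rmorph0.
have /mxOverP sr := hermitian_spectral_diag_real Bh.
have /hermitian_normalmx/orthomx_spectralP BE := Bh.
pose v i := complex.Re (spectral_diag B 0 i).
have vE : spectral_diag B = \row_i f (v i).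
  by apply/rowP => i; rewrite mxE; have := sr 0 i => /RRe_real.
exists (spectralmx B), v; rewrite spectral_unit -vE; split=> //.
apply: prod_XsubC_eq; have [_ <-] := eigvalsP R G.
apply: (@map_poly_inj _ _ f); rewrite map_char_poly -/B [in RHS]BE vE.
rewrite char_poly_diag_similar ?spectral_unit// big_image/= rmorph_prod/=.
by apply: eq_bigr => i _; rewrite map_polyXsubC.
Qed.

Lemma sum_ev (f : R -> R) (v : 'I_n -> R) :
  perm_eq [seq v i | i : 'I_n] (eigvals R G) -> \sum_i f (ev i) = \sum_i f (v i).
Proof.
move=> vp; rewrite -(big_image _ _ v xpredT f)/= (perm_big _ vp)/=.
by rewrite (big_nth 0) size_eigvals big_mkord.
Qed.

(** This is the number of closed walks of length [k]. *)
Lemma ck_trace k : ck R k G = \tr (A ^+ k).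
Proof.
have [P [v [Pu vp AE]]] := diagonalization.
apply: (@complexI R); rewrite ckE (sum_ev (fun x => x ^+ k) vp) rmorph_sum/=.
have -> : (\tr (A ^+ k))%:C%C = \tr (map_mx (real_complex R) A ^+ k).
  rewrite -trace_map_mx; congr (\tr _).
  elim: k => [|k IH]; first by rewrite !expr0 map_mx1.
  by rewrite !exprS map_mxM IH.
pose D := diag_mx (\row_i real_complex R (v i)).
have Ak : map_mx (real_complex R) A ^+ k = invmx P *m D ^+ k *m P.
  elim: k => [|k IH]; first by rewrite !expr0 mulmx1 mulVmx.
  rewrite !exprS IH AE -!mulmxE -/D !mulmxA; congr (_ *m _).
  by rewrite -!mulmxA [P *m (_ *m _)]mulmxA mulmxV// mul1mx.
have Dk : D ^+ k = diag_mx (\row_i (real_complex R (v i)) ^+ k).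
  elim: k {Ak} => [|k IH].
    by rewrite expr0; apply/matrixP => i j; rewrite !mxE expr0.
  rewrite exprS IH -mulmxE mulmx_diag; congr diag_mx.
  by apply/rowP => i; rewrite !mxE exprS.
rewrite Ak -mulmxA mxtrace_mulC -mulmxA mulmxV// mulmx1 Dk mxtrace_diag.
by apply: eq_bigr => i _; rewrite mxE rmorphXn.
Qed.

Lemma ev_eigenvector i : exists2 v : 'rV[R]_n, v != 0 & v *m A = ev i *: v.
Proof.
have [_ cp] := eigvalsP R G.
have : eigenvalue A (ev i).
  by rewrite eigenvalue_root_char cp root_prod_XsubC mem_nth// size_eigvals; exact: ltn_ord.
by move=> /eigenvalueP[v vA v0]; exists v.
Qed.

Lemma ev_annihilated i (a b c : R) :
  A *m A *m A = a *: (A *m A) + b *: A + c%:M ->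
  ev i ^+ 3 = a * ev i ^+ 2 + b * ev i + c.
Proof.
move=> AE; have [v v0 vA] := ev_eigenvector i.
have := congr1 (mulmx v) AE; rewrite !mulmxDr -!scalemxAr !mulmxA mul_mx_scalar.
rewrite !(vA, =^~ scalemxAl) !scalerA -!scalerDl.
move=> /eqP; rewrite -subr_eq0 -scalerBl scaler_eq0 (negPf v0) orbF subr_eq0.
by move=> /eqP h; rewrite -[RHS]addrA; move: h; rewrite !exprS expr0 mulr1; lra.
Qed.

Lemma ck1 : ck R 1 G = 0.
Proof.
rewrite ck_trace expr1 /mxtrace big1// => i _.
by rewrite mxE adj_irr.
Qed.

Lemma sum_ev0 : \sum_i ev i = 0.
Proof. by have := ck1; rewrite ckE (eq_bigr _ (fun i _ => expr1 (ev i))). Qed.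

Lemma ck_ge0 k : 0 <= ck R k G.
Proof.
rewrite ck_trace; apply: sumr_ge0 => i _.
move: {2}i => j; elim: k i j => [|k IH] i j; first by rewrite expr0 mxE ler0n.
rewrite exprS mxE; apply: sumr_ge0 => l _; rewrite mulr_ge0// mxE.
by case: (G i l).
Qed.

End spectrum.

Lemma exprn_unbounded (R : realType) (q N : R) : 1 < q -> exists2 k, odd k & N < q ^+ k.
Proof.
move=> q1; pose h := q - 1; have h0 : 0 < h by rewrite subr_gt0.
have b k : 1 + k%:R * h <= q ^+ k.
  elim: k => [|k IH]; first by rewrite expr0 mul0r addr0.
  have := ler_wpM2l (ltW (lt_trans ltr01 q1)) IH; rewrite -exprS -natr1 /h.
  have : 0 <= k%:R * h ^+ 2 by rewrite mulr_ge0// sqr_ge0.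
  by rewrite /h; lra.
pose K := Num.bound `|N / h|; exists (K.*2.+1); first by rewrite /= odd_double.
apply: lt_le_trans (b _).
have NK : N < K%:R * h.
  rewrite -ltr_pdivrMr//; apply: le_lt_trans (ler_norm _) _.
  exact: archi_boundP.
apply: lt_trans NK _; rewrite -[ltLHS]add0r ltr_leD// ler_pM2r// ler_nat.
by rewrite -addnn; lia.
Qed.

Section ordered_spectrum.
Context {R : realType} {n : nat} (G : sgraph n.+1).
Local Notation lam := (@ev R n.+1 G).

Lemma ev_max_ge0 : 0 <= lam ord0.
Proof.
have : \sum_i lam i <= \sum_(i < n.+1) lam ord0.
  by apply: ler_sum => i _; exact: ev_nonincreasing.
by rewrite sum_ev0 sumr_const card_ord pmulrn_lge0.
Qed.

(** For odd [k] there is a nonnegative number of closed walks of length [k].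
    An eigenvalue below [- lam ord0] would dominate the other terms of this
    power sum for large odd [k] and make it negative. *)
Lemma ev_norm_le (i : 'I_n.+1) : `|lam i| <= lam ord0.
Proof.
have L0 := ev_max_ge0; set L := lam ord0 in L0 *.
have top j : lam j <= L by exact: ev_nonincreasing.
rewrite ler_norml top andbT lerNl leNgt; apply/negP => Lm.
set m := - lam i in Lm *.
(* The walk count of odd length k, with the term of lam i isolated. *)
have mk k : odd k -> m ^+ k <= n%:R * L ^+ k.
  move=> ok; have := @ck_ge0 R n.+1 G k; rewrite ckE (bigD1 i)//=.
  have -> : lam i ^+ k = - m ^+ k by rewrite /m exprNn -signr_odd ok expr1 mulN1r opprK.
  have : \sum_(j | j != i) lam j ^+ k <= \sum_(j < n.+1 | j != i) L ^+ k.
    apply: ler_sum => j _; have [j0|j0] := leP 0 (lam j).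
      by rewrite lerXn2r// nnegrE.
    apply: (@le_trans _ _ 0); last exact: exprn_ge0.
    by rewrite exprn_odd_le0// ltW.
  by rewrite sumr_const cardC1 card_ord mulr_natl; lra.
have [L_eq0|L_neq0] := eqVneq L 0.
  have := mk 1%N isT; rewrite !expr1 L_eq0 mulr0.
  by move=> /le_lt_trans/(_ (le_lt_trans L0 Lm)); rewrite ltxx.
have Lp : 0 < L by rewrite lt_neqAle eq_sym L_neq0.
have [k ok] := @exprn_unbounded R (m / L) n%:R (ltac:(by rewrite ltr_pdivlMr// mul1r)).
by rewrite expr_div_n ltr_pdivlMr ?exprn_gt0// ltNge mk.
Qed.

(** Changing the signs of the coordinates in one colour class conjugates the
    adjacency matrix to its opposite, so the multiset of eigenvalues is invariant
    under negation. *)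
Lemma ev_symmetric (i : 'I_n.+1) : bipartite G -> lam (rev_ord i) = - lam i.
Proof.
move=> [c cP].
pose s := eigvals R G.
have [so cp] := eigvalsP R G.
pose D : 'M[R]_n.+1 := diag_mx (\row_i (-1) ^+ c i).
have DD : D *m D = 1%:M.
  rewrite mulmx_diag -diag_const_mx; congr diag_mx.
  by apply/rowP => j; rewrite !mxE -expr2 sqrr_sign.
have [Du _] := mulmx1_unit DD.
have DV : invmx D = D by rewrite -[LHS]mulmx1 -DD mulKmx.
have DAD : invmx D *m adj_matrix R G *m D = - adj_matrix R G.
  rewrite DV; apply/matrixP => j k.
  rewrite mul_mx_diag mul_diag_mx !mxE.
  have := cP j k; case: (G j k) => [/(_ isT)|_]; last by rewrite mulr0 mul0r oppr0.
  by case: (c j) (c k) => [] []//= _; rewrite ?expr0 ?expr1; ring.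
have [P [v [Pu vp AE]]] := @diagonalization R _ G.
pose f := real_complex R.
have pe : perm_eq [seq - v i | i : 'I_n.+1] s.
  apply: prod_XsubC_eq; rewrite -cp -(char_poly_similar _ Du) DAD.
  apply: (@map_poly_inj _ _ f); rewrite map_char_poly map_mxN AE.
  have -> : - (invmx P *m diag_mx (\row_i0 f (v i0)) *m P) =
      invmx P *m diag_mx (\row_i0 f (- v i0)) *m P.
    rewrite -mulNmx -mulmxN; congr (_ *m _ *m _).
    apply/matrixP => j k; rewrite !mxE /f [real_complex R (- _)]rmorphN.
    by case: (j == k); rewrite ?mulr1n// !mulr0n oppr0.
  rewrite char_poly_diag_similar// big_image/= rmorph_prod/=.
  by apply: eq_bigr => j _; rewrite map_polyXsubC.
have sE : rev [seq - x | x <- s] = s.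
  have tr : transitive (>=%R : rel R) by move=> a b d ba db; exact: le_trans db ba.
  have an : antisymmetric (>=%R : rel R) by move=> a b; rewrite andbC => /le_anti.
  apply: (sorted_eq tr an) => //.
    rewrite rev_sorted sorted_map; apply: sub_sorted so => a b /=.
    by rewrite lerN2.
  rewrite perm_rev; apply: perm_trans pe.
  have -> : [seq - v i | i : 'I_n.+1] = [seq - x | x <- [seq v i | i : 'I_n.+1]].
    by rewrite -map_comp.
  by rewrite perm_map// perm_sym.
rewrite /ev /lambda -/s -{1}sE.
have sz : size s = n.+1 by rewrite size_eigvals.
rewrite nth_rev ?size_map ?sz; last exact: ltn_ord.
rewrite (nth_map 0) ?sz; last by rewrite /= subSS; lia.
by congr (- _`__) => /=; have := ltn_ord i; lia.
Qed.

End ordered_spectrum.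

(** * The eigenvalue inequalities *)

Section blocks.
Context {R : realType} {n : nat} (G : sgraph n.+1).
Local Notation lam := (@ev R n.+1 G).
Local Notation r := (n.+1)./2.
Local Notation rho := (r%:R : R).
Local Notation c2 := (ck R 2 G).
Local Notation c4 := (ck R 4 G).

Lemma rad4E : rad4 lam = 3 * c2 ^+ 2 - 2 * c4.
Proof. by rewrite /rad4 -!ckE. Qed.

Lemma c4_le : c4 * (n.+1%:R * (n.+1%:R - 1)) ^+ 2 <=
   c2 ^+ 2 * (n.+1%:R * (n.+1%:R - 1) * (n.+1%:R ^+ 2 - 3 * n.+1%:R + 3)).
Proof.
pose s := [seq lam i | i : 'I_n.+1].
have := @sum4_le_zero_sum _ s; rewrite !big_image size_image card_ord/=.
rewrite -!ckE sum_ev0 => /(_ erefl).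
have N1 : 0 <= n.+1%:R * (n.+1%:R - 1) :> R by rewrite mulr_ge0// subr_ge0 ler1n.
by move=> /(ler_wpM2l N1); lra.
Qed.

Lemma half_bounds : (r <= n.+1 - r)%N /\ (n.+1 - r <= n.+1)%N /\
  (n.+1 - r = if odd n.+1 then r.+1 else r)%N.
Proof. by have := odd_double_half n.+1; rewrite -addnn; case: (odd _); lia. Qed.

Lemma split_blocks (f : nat -> R) : \sum_(i < n.+1) f i =
  \sum_(0 <= i < r) f i + \sum_(r <= i < n.+1 - r) f i +
  \sum_(n.+1 - r <= i < n.+1) f i.
Proof.
have [h1 [h2 _]] := half_bounds.
by rewrite -(big_mkord predT f) (@big_cat_nat _ _ _ (n.+1 - r)%N)//= (@big_cat_nat _ _ _ r).
Qed.

(** The eigenvalues are cut into the [r] largest ones, the [r] smallest ones,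
    and the middle one when the order is odd; [mid] is empty otherwise. *)
Definition blk (a b : nat) : R := \sum_(a <= j < b) lambda R G j.+1.
Local Notation top := (blk 0 r).
Local Notation mid := (blk r (n.+1 - r)).
Local Notation bot := (blk (n.+1 - r) n.+1).

Lemma blocks0 : top + mid + bot = 0.
Proof. by rewrite -split_blocks sum_ev0. Qed.

Lemma lam_top i : (i <= r)%N -> lambda R G r.+1 <= lambda R G i.+1.
Proof.
move=> ir; have rn : (r < n.+1)%N by have := odd_double_half n.+1; rewrite -addnn; lia.
exact: (@ev_nonincreasing R _ G (Ordinal (leq_ltn_trans ir rn)) (Ordinal rn)).
Qed.

Lemma lam_bot i : (n.+1 - r <= i < n.+1)%N -> lambda R G i.+1 <= lambda R G r.+1.
Proof.
have [h1 _] := half_bounds; move=> /andP[ri iN].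
have rn : (r < n.+1)%N by apply: leq_ltn_trans iN; lia.
apply: (@ev_nonincreasing R _ G (Ordinal rn) (Ordinal iN)) => /=; lia.
Qed.

Lemma midE : mid = if odd n.+1 then lambda R G r.+1 else 0.
Proof.
have [_ [_ ->]] := half_bounds; rewrite /blk; case: ifP => _; last by rewrite big_geq.
by rewrite big_nat1.
Qed.

Lemma top_ge : rho * lambda R G r.+1 <= top.
Proof.
rewrite mulr_natl -[X in _ *+ X]subn0 -sumr_const_nat /blk; apply: ler_sum_nat => i /andP[_ ir].
by apply: lam_top; exact: ltnW.
Qed.

Lemma bot_le : bot <= rho * lambda R G r.+1.
Proof.
have [h1 [h2 _]] := half_bounds.
have rE : r = (n.+1 - (n.+1 - r))%N by lia.
rewrite mulr_natl [X in _ *+ X]rE -sumr_const_nat /blk; apply: ler_sum_nat => i.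
exact: lam_bot.
Qed.

(** The spectrum of [M_n] in decreasing order; its multiple by [beta] is
    majorized by the spectrum of [G]. *)
Definition blk_sign (i : nat) : R :=
  if (i < r)%N then 1 else if (i < n.+1 - r)%N then 0 else -1.

Lemma blk_signE (g : R -> R) (f : nat -> R) :
  \sum_(i < n.+1) g (blk_sign i) * f i =
  g 1 * (\sum_(0 <= i < r) f i) + g 0 * (\sum_(r <= i < n.+1 - r) f i) +
  g (-1) * (\sum_(n.+1 - r <= i < n.+1) f i).
Proof.
have [h1 [h2 _]] := half_bounds.
rewrite (split_blocks (fun i => g (blk_sign i) * f i)) !mulr_sumr; congr (_ + _ + _).
- by apply: eq_big_nat => i /andP[_ ir]; rewrite /blk_sign ir.
- by apply: eq_big_nat => i /andP[ri ir]; rewrite /blk_sign ltnNge ri/= ir.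
- apply: eq_big_nat => i /andP[ri ir]; rewrite /blk_sign !ltnNge ri/=.
  by rewrite (leq_trans h1 ri).
Qed.

Lemma signed_sum : \sum_(i < n.+1) blk_sign i * lam i = top - bot.
Proof.
rewrite (blk_signE id (fun i => lambda R G i.+1)).
by rewrite mul1r mul0r addr0 mulN1r.
Qed.

End blocks.

Section bounds.
Context {R : realType} {n : nat} (n_gt0 : (0 < n)%N) (G : sgraph n.+1).
Local Notation lam := (@ev R n.+1 G).
Local Notation r := (n.+1)./2.
Local Notation rho := (r%:R : R).
Local Notation c2 := (ck R 2 G).
Local Notation c4 := (ck R 4 G).
Local Notation top := (blk (R := R) G 0 r).
Local Notation mid := (blk (R := R) G r (n.+1 - r)).

Lemma half_size_ge1 : 1 <= rho.
Proof. by rewrite (ler_nat _ 1) /=; case: (n) n_gt0. Qed.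

Lemma lam1_ge : c4 / (2 * rho) <= lam ord0 ^+ 4.
Proof.
have r1 := half_size_ge1; rewrite ler_pdivrMr; last lra.
by rewrite mulrC ckE; apply: sum4_le_max4; [exact: sum_ev0|exact: ev_norm_le].
Qed.

Lemma lam1_le : lam ord0 ^+ 4 <= c4 / (1 + (n.+1%:R - 1) ^- 3).
Proof.
rewrite ler_pdivlMr; first by rewrite ckE sum4_ge_entry ?sum_ev0.
by rewrite ltr_wpDr// invr_ge0 exprn_ge0// subr_ge0 ler1n.
Qed.

Lemma energy_ge : 8 * c4 + 6 * pos_part (c2 ^+ 2 - 2 * c4) <= energy R G ^+ 4.
Proof.
have [h4 hr] := sum_norm_ge (@sum_ev0 R _ G).
rewrite rad4E -energyE in hr; rewrite -ckE -energyE in h4.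
by rewrite /pos_part maxEle; case: ifP => _; lra.
Qed.

Lemma lamn_ge : (3 * c2 ^+ 2 - 2 * c4) /
  (n.+1%:R * (n.+1%:R - 1) * (n.+1%:R ^+ 2 + 3 * n.+1%:R - 6)) <= lam ord_max ^+ 4.
Proof.
have N2 : 2 <= n.+1%:R :> R by rewrite (ler_nat _ 2).
have D0 : 0 < n.+1%:R * (n.+1%:R - 1) * (n.+1%:R ^+ 2 + 3 * n.+1%:R - 6) :> R.
  by rewrite !mulr_gt0//; nra.
rewrite ler_pdivrMr// -rad4E [leRHS]mulrC.
rewrite -(@ger0_norm _ (lam ord_max ^+ 4)) ?exprn_even_ge0// normrX.
apply: rad4_le_min4 => //; first exact: sum_ev0.
move=> i; apply: le_trans (@ev_nonincreasing R _ G i ord_max _); last first.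
  by rewrite -ltnS.
by rewrite lerNl -normrN ler_norm.
Qed.

Lemma lamn_le : lam ord_max ^+ 4 <=
  (4 * c4 - 3 * pos_part (2 * c4 - c2 ^+ 2)) / 8.
Proof.
have m4 : lam ord_max ^+ 4 = `|lam ord_max| ^+ 4.
  by rewrite -normrX ger0_norm// exprn_even_ge0.
have lm : `|lam ord_max| <= `|lam ord0|.
  by rewrite (ger0_norm (ev_max_ge0 _)) ev_norm_le.
have mx : ord_max != ord0 :> 'I_n.+1 by rewrite -val_eqE /= -lt0n.
have h8 : 8 * lam ord_max ^+ 4 <= 3 * c2 ^+ 2 - 2 * c4.
  by rewrite m4 -rad4E; apply: (rad4_ge_two mx).
have h2 : 2 * lam ord_max ^+ 4 <= c4.
  rewrite ckE (bigD1 ord0)//= (bigD1 ord_max)//= addrA.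
  have l4 : lam ord_max ^+ 4 <= lam ord0 ^+ 4.
    rewrite m4 -[leRHS]ger0_norm ?exprn_even_ge0// normrX.
    by rewrite lerXn2r// nnegrE.
  have : 0 <= \sum_(i < n.+1 | (i != ord0) && (i != ord_max)) lam i ^+ 4.
    by apply: sumr_ge0 => i _; exact: exprn_even_ge0.
  by lra.
by rewrite /pos_part maxEle; case: ifP => _; lra.
Qed.

Lemma betaE : rho * beta R G = top + Num.min 0 mid.
Proof.
have r1 := half_size_ge1.
have oh := odd_double_half n.+1; rewrite midE /beta /blk.
have nr : n.+1%:R = (odd n.+1)%:R + 2 * rho :> R.
  by rewrite -[in LHS]oh natrD -mul2n natrM.
case: ifP oh nr => od oh nr; last first.
  rewrite minxx addr0 nr big_add1/= add0r.
  by field; rewrite gt_eqF//; lra.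
have -> : (n.+1.-1)./2 = r by rewrite /=; move: oh; rewrite -addnn/=; lia.
have -> : (n.+2)./2 = r.+1 by move: oh; rewrite -addnn/=; lia.
rewrite nr big_add1/= (_ : true%:R + 2 * rho - 1 = 2 * rho); last by rewrite mulr1n; ring.
by field; rewrite gt_eqF//; lra.
Qed.

(** The mean of the [r] largest eigenvalues is at least the mean zero of all of
    them; a negative middle eigenvalue is compared with the smallest ones. *)
Lemma beta_ge0 : 0 <= beta R G.
Proof.
have r1 := half_size_ge1.
rewrite -(@pmulr_rge0 _ rho); last lra.
have := blocks0 (R := R) G; have := top_ge (R := R) G; have := bot_le (R := R) G.
rewrite betaE midE.
move: (lambda _ _ _) top (blk (R := R) G (n.+1 - r) n.+1) => t T B hB hT; case: ifP => _ h.
  rewrite minEle; case: ifPn => [t0|]; rewrite -?ltNge.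
    have : 0 <= rho * t by rewrite mulr_ge0//; lra.
    by lra.
  move=> t0; have : rho * t <= 0 by rewrite mulr_ge0_le0//; lra.
  by lra.
by rewrite minxx; lra.
Qed.

Lemma beta_le : beta R G ^+ 4 <= (3 * c2 ^+ 2 - 2 * c4) / (12 * rho ^+ 2 - 4 * rho).
Proof.
have r1 := half_size_ge1.
have D0 : 0 < 12 * rho ^+ 2 - 4 * rho by nra.
rewrite ler_pdivlMr// -rad4E [leLHS]mulrC.
have [h1 [h2 _]] := @half_bounds n.
have -> : 12 * rho ^+ 2 - 4 * rho = 3 * (2 * rho) ^+ 2 - 2 * (2 * rho) by ring.
apply: (@rad4_ge_signed _ _ _ (fun i : 'I_n.+1 => @blk_sign R n i)); rewrite ?beta_ge0//; first lra.
- move=> i; rewrite /blk_sign; case: ifP => _; first by rewrite expr1n.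
  by case: ifP => _; [rewrite expr0n|ring].
- under eq_bigr do rewrite -[_ ^+ 2]mulr1.
  rewrite (@blk_signE R n (fun x => x ^+ 2) (fun=> 1)) !sumr_const_nat subn0.
  have -> : (n.+1 - (n.+1 - r))%N = r by lia.
  by rewrite sqrrN expr0n/= expr1n; ring.
- rewrite signed_sum -mulrA betaE; have := blocks0 (R := R) G.
  have : 2 * Num.min 0 mid <= mid by rewrite minEle; case: ifP => [|/negbT]; rewrite -?ltNge; lra.
  by lra.
Qed.

End bounds.

Section bipartite_bounds.
Context {R : realType} {n : nat} (n_gt0 : (0 < n)%N) (G : sgraph n.+1).
Hypothesis bG : bipartite G.
Local Notation lam := (@ev R n.+1 G).
Local Notation r := (n.+1)./2.
Local Notation rho := (r%:R : R).

Lemma lamn_bipartite : lam ord_max = - lam ord0.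
Proof. by rewrite -(ev_symmetric ord0 bG); congr ev; apply: val_inj; rewrite /= subn1. Qed.

(** By symmetry the largest eigenvalues are nonnegative, the smallest are
    nonpositive and the middle one vanishes, so the energy is [top - bot]. *)
Lemma energy_bipartite : energy R G = 2 * rho * beta R G.
Proof.
have [h1 [h2 h3]] := @half_bounds n.
have oh := odd_double_half n.+1; rewrite -addnn in oh.
have top0 (i : 'I_n.+1) : (i <= n - i)%N -> 0 <= lam i.
  move=> ii; have := @ev_nonincreasing R _ G i (rev_ord i).
  by rewrite /= subSS ii ev_symmetric// => /(_ isT); lra.
have bot0 (i : 'I_n.+1) : (n - i <= i)%N -> lam i <= 0.
  move=> ii; have := @ev_nonincreasing R _ G (rev_ord i) i.
  by rewrite /= subSS ii ev_symmetric// => /(_ isT); lra.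
have mid0 : blk (R := R) G r (n.+1 - r) = 0.
  rewrite midE; case: ifP => // od.
  have rn : (r < n.+1)%N by lia.
  by apply/eqP; rewrite eq_le (bot0 (Ordinal rn)) ?(top0 (Ordinal rn))//=; lia.
have -> : energy R G = blk (R := R) G 0 r - blk (R := R) G (n.+1 - r) n.+1.
  rewrite -signed_sum energyE; apply: eq_bigr => i _; rewrite /blk_sign.
  case: ifPn => ir; first by rewrite mul1r ger0_norm// top0//; lia.
  case: ifPn => ir2.
    rewrite mul0r; apply/normr0P; rewrite eq_le bot0 ?top0//; lia.
  by rewrite mulN1r ler0_norm// bot0//; lia.
rewrite -mulrA betaE// mid0 minxx.
by have := blocks0 (R := R) G; rewrite mid0; lra.
Qed.

Lemma energy_le : energy R G ^+ 4 <=
  4 * rho ^+ 3 * (3 * ck R 2 G ^+ 2 - 2 * ck R 4 G) / (3 * rho - 1).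
Proof.
have r1 := half_size_ge1 (R := R) n_gt0.
have := beta_le (R := R) n_gt0 G; rewrite energy_bipartite.
have r4 : 0 <= (2 * rho) ^+ 4 by rewrite exprn_ge0//; lra.
move=> /(ler_wpM2l r4); rewrite -exprMn => /le_trans; apply.
rewrite le_eqVlt; apply/orP; left; apply/eqP; field.
by apply/andP; split; rewrite gt_eqF//; nra.
Qed.
End bipartite_bounds.

(** * Degrees, common neighbours and the extremal graphs *)

Section counting.
Context {R : realType} {n : nat} (G : sgraph n).
Local Notation A := (adj_matrix R G).

Definition deg (i : 'I_n) : nat := \sum_j G i j.
Definition codeg (i j : 'I_n) : nat := \sum_k G i k * G k j.

Lemma adj_sqr i j : (A *m A) i j = (codeg i j)%:R.
Proof.
by rewrite mxE natr_sum; apply: eq_bigr => k _; rewrite !mxE natrM.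
Qed.

Lemma codegC i j : codeg i j = codeg j i.
Proof.
by apply: eq_bigr => k _; rewrite mulnC adj_sym [G i k]adj_sym.
Qed.

Lemma codegii i : codeg i i = deg i.
Proof. by apply: eq_bigr => k _; rewrite [G k i]adj_sym mulnb andbb. Qed.

Lemma ck2_deg : ck R 2 G = \sum_i (deg i)%:R.
Proof.
by rewrite ck_trace expr2 -mulmxE; apply: eq_bigr => i _; rewrite adj_sqr codegii.
Qed.

Lemma ck4_codeg : ck R 4 G = \sum_i \sum_j (codeg i j)%:R ^+ 2.
Proof.
rewrite ck_trace (exprM _ 2 2) !expr2 -!mulmxE; apply: eq_bigr => i _; rewrite mxE.
by apply: eq_bigr => j _; rewrite !adj_sqr [codeg j i]codegC expr2.
Qed.

Lemma sum_codeg : \sum_i \sum_j (codeg i j)%:R = \sum_i (deg i)%:R ^+ 2 :> R.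
Proof.
under eq_bigr => i _ do rewrite -natr_sum exchange_big/= natr_sum.
rewrite exchange_big/=; apply: eq_bigr => k _.
under eq_bigr => i _ do rewrite -big_distrr/= -/(deg k) natrM adj_sym.
by rewrite -mulr_suml -natr_sum -/(deg k) expr2.
Qed.

(** [ck R 4 G] is the sum of the squares of the numbers of common neighbours.
    The diagonal terms are the squared degrees; off the diagonal, a square of a
    natural number is bounded below by the number itself. *)
Lemma ck4_ge_deg :
  2 * (\sum_i (deg i)%:R ^+ 2) - \sum_i (deg i)%:R <= ck R 4 G.
Proof.
have -> : 2 * (\sum_i (deg i)%:R ^+ 2) - \sum_i (deg i)%:R =
    \sum_i (\sum_j (codeg i j)%:R + ((deg i)%:R ^+ 2 - (deg i)%:R)) :> R.
  by rewrite big_split/= sumrB sum_codeg; ring.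
rewrite ck4_codeg; apply: ler_sum => i _.
rewrite (bigD1 i)//= [leRHS](bigD1 i)//= codegii.
rewrite (_ : _ + _ + _ = (deg i)%:R ^+ 2 + \sum_(j < n | j != i) (codeg i j)%:R); last by ring.
rewrite lerD2l; apply: ler_sum => j _; rewrite -natrX ler_nat.
by case: (codeg i j) => // k; rewrite expnS expn1 leq_pmulr.
Qed.

(** The handshake lemma: each edge is counted from both of its ends. *)
Lemma sum_deg_even : ~~ odd (\sum_i deg i).
Proof.
have -> : (\sum_i deg i = \sum_(i < n) \sum_(j < n | (i < j)%N) G i j +
    \sum_(i < n) \sum_(j < n | (i < j)%N) G i j)%N.
  rewrite [X in (_ = _ + X)%N](exchange_big_dep predT)//= -big_split/=.
  apply: eq_bigr => i _; rewrite /deg (bigID (fun j : 'I_n => (i < j)%N))/=.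
  congr (_ + _)%N; rewrite (bigD1 i) ?ltnn//= adj_irr add0n.
  apply: eq_big => [j|j _]; last by rewrite adj_sym.
  by rewrite -leqNgt ltn_neqAle andbC.
by rewrite addnn odd_double.
Qed.

(** For even [n] this is the Cauchy-Schwarz inequality for the squared
    eigenvalues.  For odd [n] the factor is [n - 1] instead of [n], which is not
    a consequence of the eigenvalues having sum zero; both sides are then
    estimated in terms of the degrees. *)
Lemma ck2_sqr_le : (1 < n)%N -> ck R 2 G ^+ 2 <= 2 * (n./2)%:R * ck R 4 G.
Proof.
move=> n1; have oh := odd_double_half n; rewrite -mul2n in oh.
case: (boolP (odd n)) oh => [on|en] oh.
  rewrite (_ : 2 * (n./2)%:R = n%:R - 1 :> R); last first.
    by rewrite -[in RHS]oh natrD natrM addrAC subrr add0r.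
  rewrite ck2_deg; apply: le_trans (sqr_sum_degrees_le _ on sum_deg_even) _.
    by move: on n1; case: (n) => [|[|[|]]].
  by rewrite ler_wpM2l ?ck4_ge_deg// subr_ge0 ler1n ltnW.
rewrite (_ : 2 * (n./2)%:R = n%:R :> R); last by rewrite -[in RHS]oh natrM.
rewrite !ckE; have := sqr_sum_le predT (fun i => (ev G i : R) ^+ 2).
rewrite card_ord => /le_trans; apply; rewrite le_eqVlt; apply/orP; left.
by apply/eqP; congr (_ * _); apply: eq_bigr => i _; rewrite -exprM.
Qed.
End counting.

Section graphs_of_degree_at_most_one.
Context {R : realType} {n : nat} (G : sgraph n).
Hypothesis G1 : forall i j k, G i j -> G i k -> j = k.
Local Notation A := (adj_matrix R G).

Lemma codeg_matching i j : i != j -> codeg G i j = 0%N.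
Proof.
move=> ij; apply: big1 => k _; case Gik : (G i k) => //; case Gkj : (G k j) => //.
by rewrite adj_sym in Gik; rewrite (G1 Gik Gkj) eqxx in ij.
Qed.

Lemma deg_matching i j : G i j -> deg G i = 1%N.
Proof.
move=> Gij; rewrite /deg (bigD1 j)//= Gij big1// => k kj.
by case Gik : (G i k) => //; rewrite (G1 Gij Gik) eqxx in kj.
Qed.

(** The square of the adjacency matrix is the diagonal matrix of the degrees,
    which are one at each vertex having a neighbour. *)
Lemma matching_cube : A *m A *m A = A.
Proof.
apply/matrixP => i j; rewrite mxE (bigD1 i)//= big1 => [|k ki]; last first.
  by rewrite adj_sqr codeg_matching ?mul0r// eq_sym.
rewrite addr0 adj_sqr codegii mxE.
by case Gij : (G i j); rewrite ?mulr0// (deg_matching Gij) mulr1.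
Qed.

Lemma ck4_matching : ck R 4 G = ck R 2 G.
Proof. by rewrite !ck_trace !exprS expr0 mulr1 -!mulmxE !mulmxA matching_cube. Qed.

Lemma ev_cube_matching i : (ev G i : R) ^+ 3 = ev G i.
Proof.
have /(@ev_annihilated R _ G i) : A *m A *m A = 0 *: (A *m A) + 1 *: A + 0%:M.
  by rewrite matching_cube scale0r scale1r add0r raddf0 addr0.
by move=> ->; rewrite mul0r mul1r add0r addr0.
Qed.

(** The eigenvalues are roots of [x^3 = x]. *)
Lemma ev_norm_matching i : `|ev G i : R| = ev G i ^+ 2.
Proof.
have := ev_cube_matching i; set x := ev G i => /eqP.
rewrite -subr_eq0 (_ : x ^+ 3 - x = x * ((x - 1) * (x + 1))); last by ring.
rewrite !mulf_eq0 subr_eq0 addr_eq0 => /or3P[] /eqP ->.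
- by rewrite normr0 expr0n.
- by rewrite normr1 expr1n.
- by rewrite normrN normr1 sqrrN expr1n.
Qed.

Lemma energy_matching : energy R G = ck R 2 G.
Proof. by rewrite energyE ckE; apply: eq_bigr => i _; exact: ev_norm_matching. Qed.

End graphs_of_degree_at_most_one.

Lemma ev0_matching (R : realType) n (G : sgraph n.+1) :
  (forall i j k, G i j -> G i k -> j = k) -> 0 < ck R 2 G -> ev G ord0 = 1 :> R.
Proof.
move=> G1 c2; have L0 := @ev_max_ge0 R _ G.
have := ev_norm_matching G1 ord0 (R := R); rewrite (ger0_norm L0) => /eqP.
rewrite -subr_eq0 (_ : ev G ord0 - _ = ev G ord0 * (1 - ev G ord0)); last by ring.
rewrite mulf_eq0 subr_eq0 => /orP[/eqP L|/eqP //].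
move: c2; rewrite ckE big1 ?ltxx// => i _.
have := @ev_norm_le R _ G i; rewrite L normr_le0 => /eqP ->; exact: expr0n.
Qed.

Lemma matching_graph_deg1 m (i j k : 'I_m) :
  matching_graph m i j -> matching_graph m i k -> j = k.
Proof.
rewrite /= => /andP[ij /eqP hij] /andP[ik /eqP hik]; apply: val_inj => /=.
rewrite -val_eqE/= in ij; rewrite -val_eqE/= in ik.
lia.
Qed.

Lemma matching_graph_bipartite m : bipartite (matching_graph m).
Proof.
exists (fun i => odd i) => i j /= /andP[ij /eqP hij]; rewrite -val_eqE/= in ij.
by apply: contra ij => /eqP o; apply/eqP; rewrite -[LHS]odd_double_half o hij odd_double_half.
Qed.

Lemma deg_matching_graph m (i : 'I_m) : deg (matching_graph m) i = (i < (m./2).*2)%N.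
Proof.
have im := ltn_ord i; have oh := odd_double_half m.
have [ir|ri] := ltnP i (m./2).*2.
  pose k := if odd i then i.-1 else i.+1.
  have kE : k./2 = i./2 /\ (k < (m./2).*2)%N /\ k != i.
    by rewrite /k; case: ifP => o; lia.
  have [kh [kr ki]] := kE; have km : (k < m)%N by lia.
  rewrite (@deg_matching _ _ (@matching_graph_deg1 m) _ (Ordinal km))//=.
  by rewrite -val_eqE/= eq_sym ki kh eqxx.
rewrite /deg big1// => j _; apply/eqP; rewrite eqb0 negb_and negbK.
have jm := ltn_ord j; rewrite -val_eqE/=; case: eqP => //= ij.
by apply/eqP; lia.
Qed.

Lemma ck2_matching_graph (R : realType) m : ck R 2 (matching_graph m) = 2 * (m./2)%:R.
Proof.
rewrite ck2_deg -natr_sum -natrM; congr (_%:R).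
under eq_bigr do rewrite deg_matching_graph.
rewrite -(big_mkord predT (fun i => (i < (m./2).*2)%N : nat)).
rewrite (@big_cat_nat _ _ _ (m./2).*2)//=; last first.
  by have := odd_double_half m; lia.
rewrite [X in (_ + X)%N]big_nat_cond [X in (_ + X)%N]big1; last first.
  by move=> i /andP[/andP[h _] _]; rewrite ltnNge h.
rewrite addn0 (eq_big_nat _ _ (F2 := fun=> 1%N)); last by move=> i /andP[_ ->].
by rewrite sum_nat_const_nat subn0 muln1 mul2n.
Qed.

Lemma ck4_matching_graph (R : realType) m : ck R 4 (matching_graph m) = 2 * (m./2)%:R.
Proof.
by rewrite (ck4_matching (@matching_graph_deg1 m)) ck2_matching_graph.
Qed.

Definition single_edge_rel (m : nat) : rel 'I_m :=
  fun i j => [&& i != j, (i < 2)%N & (j < 2)%N].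

Lemma single_edge_sym m : symmetric (@single_edge_rel m).
Proof. by move=> i j; rewrite /single_edge_rel eq_sym [X in _ && X]andbC. Qed.

Lemma single_edge_irr m : irreflexive (@single_edge_rel m).
Proof. by move=> i; rewrite /single_edge_rel eqxx. Qed.

Definition single_edge m := SGraph (@single_edge_sym m) (@single_edge_irr m).
Lemma single_edge_deg1 m (i j k : 'I_m) :
  single_edge m i j -> single_edge m i k -> j = k.
Proof.
rewrite /= /single_edge_rel -!val_eqE/= => /and3P[a b c] /and3P[d e f].
apply: val_inj => /=; lia.
Qed.

Lemma single_edge_bipartite m : bipartite (single_edge m).
Proof.
exists (fun i => (i == 0 :> nat)) => i j.
rewrite /= /single_edge_rel -!val_eqE/= => /and3P[a b c].
by case: (nat_of_ord i) (nat_of_ord j) a b c => [|[|x]] [|[|y]].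
Qed.

Section matching_graph_spectra.
Context {R : realType} {n : nat} (n_gt0 : (0 < n)%N).
Local Notation M := (matching_graph n.+1).
Local Notation rho := ((n.+1)./2%:R : R).

Local Notation K2 := (single_edge n.+1).

Lemma ev0_matching_graph : ev M ord0 = 1 :> R.
Proof.
apply: ev0_matching; first exact: matching_graph_deg1.
by rewrite ck2_matching_graph; have := half_size_ge1 (R := R) n_gt0; lra.
Qed.

Lemma energy_matching_graph : energy R M = 2 * rho.
Proof. by rewrite (energy_matching (@matching_graph_deg1 _)) ck2_matching_graph. Qed.

Lemma beta_matching_graph : beta R M = 1.
Proof.
have := energy_bipartite (R := R) n_gt0 (matching_graph_bipartite n.+1).
rewrite energy_matching_graph; have r1 := half_size_ge1 (R := R) n_gt0.
move=> h; apply: (@mulfI _ (2 * rho)); first by rewrite gt_eqF//; lra.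
by rewrite mulr1.
Qed.

Lemma matching_graph_edge : has_edge M.
Proof. by exists ord0, (Ordinal (n_gt0 : (1 < n.+1)%N)). Qed.

Lemma single_edge_edge : has_edge K2.
Proof. by exists ord0, (Ordinal (n_gt0 : (1 < n.+1)%N)). Qed.

Lemma ck2_single_edge : ck R 2 K2 = 2.
Proof.
pose o1 : 'I_n.+1 := Ordinal (n_gt0 : (1 < n.+1)%N).
rewrite ck2_deg (bigD1 ord0)//= (bigD1 o1)//= big1 ?addr0; last first.
  move=> i /andP[]; rewrite -!val_eqE/= => i0 i1; rewrite /deg big1// => j _.
  by rewrite /= /single_edge_rel; case: (nat_of_ord i) i0 i1 => [|[|k]]; rewrite ?andbF.
rewrite (@deg_matching _ _ (@single_edge_deg1 _) _ o1)//.
by rewrite (@deg_matching _ _ (@single_edge_deg1 _) _ ord0).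
Qed.

Lemma ck4_single_edge : ck R 4 K2 = 2.
Proof. by rewrite (ck4_matching (@single_edge_deg1 _)) ck2_single_edge. Qed.

Lemma energy_single_edge : energy R K2 = 2.
Proof. by rewrite (energy_matching (@single_edge_deg1 _)) ck2_single_edge. Qed.

Lemma ev0_single_edge : ev K2 ord0 = 1 :> R.
Proof.
apply: ev0_matching; first exact: single_edge_deg1.
by rewrite ck2_single_edge ltr0n.
Qed.

Lemma evn_single_edge : ev K2 ord_max = -1 :> R.
Proof. by rewrite lamn_bipartite ?ev0_single_edge//; exact: single_edge_bipartite. Qed.

End matching_graph_spectra.

Section complete_graph.
Context {R : realType} {n : nat} (n_gt0 : (0 < n)%N).
Local Notation K := (complete_graph n.+1).
Local Notation A := (adj_matrix R K).
Local Notation N := (n.+1%:R : R).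

(** [A] is [J - 1], where [J] has all entries one and [J^2 = N J]. *)
Lemma complete_graph_sqr : A *m A = (N - 2) *: A + (N - 1)%:M.
Proof.
pose J : 'M[R]_n.+1 := const_mx 1.
have AE : A = J - 1%:M.
  by apply/matrixP => i j; rewrite !mxE/=; case: eqP => _ /=; rewrite ?subrr ?subr0.
have JJ : J *m J = N *: J.
  apply/matrixP => i j; rewrite !mxE.
  under eq_bigr do rewrite !mxE mulr1.
  by rewrite sumr_const card_ord mulr1.
rewrite AE mulmxBl !mulmxBr JJ !mul1mx mulmx1 scalerBr scalemx1.
apply/matrixP => i j; rewrite !mxE.
by case: (i == j); rewrite ?mulr1n ?mulr0n; ring.
Qed.

Lemma ev_complete i : ev K i = N - 1 \/ ev K i = -1 :> R.
Proof.
have [v v0 vA] := @ev_eigenvector R _ K i.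
have := congr1 (mulmx v) complete_graph_sqr.
rewrite mulmxDr -scalemxAr mulmxA mul_mx_scalar !(vA, =^~ scalemxAl) !scalerA -scalerDl.
move=> /eqP; rewrite -subr_eq0 -scalerBl scaler_eq0 (negPf v0) orbF.
rewrite (_ : _ - _ = (ev K i - (N - 1)) * (ev K i + 1)); last by ring.
by rewrite mulf_eq0 subr_eq0 addr_eq0 => /orP[/eqP|/eqP]; [left|right].
Qed.

Lemma ev0_complete : ev K ord0 = N - 1 :> R.
Proof.
have [//|h] := ev_complete ord0.
by have := @ev_max_ge0 R _ K; rewrite h oppr_ge0 ler10.
Qed.

Lemma evn_complete : ev K ord_max = -1 :> R.
Proof.
have N2 : 2 <= N by rewrite (ler_nat _ 2).
have [h|//] := ev_complete ord_max.
have : \sum_(i < n.+1) (N - 1) <= \sum_i (ev K i : R).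
  by apply: ler_sum => i _; rewrite -h; apply: ev_nonincreasing; rewrite -ltnS.
rewrite sum_ev0 sumr_const card_ord pmulrn_lle0//; lra.
Qed.

Lemma ck2_complete : ck R 2 K = N * (N - 1).
Proof.
rewrite ck_trace expr2 -mulmxE complete_graph_sqr mxtraceD mxtraceZ mxtrace_scalar.
by have := @ck1 R _ K; rewrite ck_trace expr1 => ->; rewrite mulr0 add0r mulr_natl.
Qed.

Lemma ck4_complete : ck R 4 K = N * (N - 1) * (N ^+ 2 - 3 * N + 3).
Proof.
have sq i : (ev K i : R) ^+ 2 = (N - 2) * ev K i + (N - 1).
  by have [->|->] := ev_complete i; ring.
have qu i : (ev K i : R) ^+ 4 = ((N - 2) ^+ 2 + (N - 1)) * ev K i ^+ 2
   + (N - 2) * (N - 1) * ev K i.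
  by have [->|->] := ev_complete i; ring.
rewrite ckE (eq_bigr _ (fun i _ => qu i)) big_split/= -!mulr_sumr sum_ev0 -ckE.
by rewrite ck2_complete; ring.
Qed.

Lemma complete_graph_edge : has_edge K.
Proof. by exists ord0, (Ordinal (n_gt0 : (1 < n.+1)%N)). Qed.

End complete_graph.

Section complete_bipartite.
Context {R : realType} (r s : nat).
Local Notation K := (complete_bipartite r s).
Local Notation A := (adj_matrix R K).

Let u : 'cV[R]_(r + s) := \col_i (i < r)%N%:R.
Let v : 'cV[R]_(r + s) := \col_i (~~ (i < r)%N)%:R.

Lemma complete_bipartite_adj : A = u *m v^T + v *m u^T.
Proof.
apply/matrixP => i j; rewrite !mxE !big_ord1 !mxE/=.
by case: (i < r)%N; case: (j < r)%N; rewrite /= ?(mulr0, mulr1, addr0, add0r).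
Qed.

Let uv : u^T *m v = 0.
Proof.
apply/matrixP => i j; rewrite !mxE big1// => k _; rewrite !mxE.
by case: (k < r)%N; rewrite /= ?mulr0 ?mul0r.
Qed.

Let vu : v^T *m u = 0.
Proof. by rewrite -[LHS]trmxK trmx_mul trmxK uv trmx0. Qed.

Let uu : u^T *m u = r%:R%:M.
Proof.
apply/matrixP => i j; rewrite !ord1 !mxE mulr1n big_split_ord/= [X in _ + X]big1 ?addr0.
  under eq_bigr => k _ do rewrite !mxE/= ltn_ord mulr1.
  by rewrite sumr_const card_ord.
by move=> k _; rewrite !mxE/= ltnNge leq_addr mulr0.
Qed.

Let vv : v^T *m v = s%:R%:M.
Proof.
apply/matrixP => i j; rewrite !ord1 !mxE mulr1n big_split_ord/= big1 ?add0r.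
  under eq_bigr => k _ do rewrite !mxE/= ltnNge leq_addr mulr1.
  by rewrite sumr_const card_ord.
by move=> k _; rewrite !mxE/= ltn_ord mulr0.
Qed.

Lemma complete_bipartite_sqr :
  A *m A = s%:R *: (u *m u^T) + r%:R *: (v *m v^T).
Proof.
rewrite complete_bipartite_adj mulmxDl !mulmxDr !mulmxA.
rewrite -[u *m v^T *m u]mulmxA vu -[u *m v^T *m v]mulmxA vv.
rewrite -[v *m u^T *m u]mulmxA uu -[v *m u^T *m v]mulmxA uv.
by rewrite !mulmx0 !mul0mx add0r addr0 !mul_mx_scalar !scalemxAl.
Qed.

Lemma ck2_complete_bipartite : ck R 2 K = 2 * (r%:R * s%:R).
Proof.
rewrite ck_trace expr2 -mulmxE complete_bipartite_sqr mxtraceD !mxtraceZ.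
rewrite ![\tr (_ *m _^T)]mxtrace_mulC uu vv !mxtrace_scalar.
by rewrite !mulr1n; ring.
Qed.

Lemma ck4_complete_bipartite : ck R 4 K = 2 * (r%:R * s%:R) ^+ 2.
Proof.
rewrite ck_trace (exprM _ 2 2) !expr2 -!mulmxE complete_bipartite_sqr.
rewrite mulmxDl !mulmxDr -!scalemxAl -!scalemxAr !mulmxA.
rewrite -[u *m u^T *m u]mulmxA uu -[u *m u^T *m v]mulmxA uv.
rewrite -[v *m v^T *m u]mulmxA vu -[v *m v^T *m v]mulmxA vv.
rewrite !mulmx0 !mul0mx !scaler0 addr0 add0r !mul_mx_scalar -!scalemxAl.
rewrite mxtraceD !mxtraceZ ![\tr (_ *m _^T)]mxtrace_mulC uu vv !mxtrace_scalar.
by rewrite !mulr1n; ring.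
Qed.
End complete_bipartite.

(** * Finiteness of the gamma factor *)

Section gamma.
Context {R : realType}.
Local Notation mu := (@lebesgue_measure R).

(** The real-valued integral would be zero if the integral diverged, so
    both a positive lower bound (from the interval [1, 2]) and a finite upper
    bound (a multiple of an exponential density) are needed. *)
Lemma Gamma_natr_gt0 (k : nat) : 0 < Gamma (k.+1%:R + 1 : R).
Proof.
rewrite /Gamma /Rintegral addrK.
set f := fun t : R => (t `^ k.+1%:R * expR (- t))%:E.
have mf (D : set R) : measurable_fun D f.
  apply/measurable_EFinP; apply: measurable_funTS; apply: measurable_funM.
    exact: measurable_powR.
  by apply: measurableT_comp.
have f0 t : (0 <= f t)%E by rewrite lee_fin mulr_ge0// ?powR_ge0 ?expR_ge0.
have lo : ((expR (-2))%:E <= \int[mu]_(t in `]0%R, +oo[) f t)%E.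
  apply: (@le_trans _ _ (\int[mu]_(t in `[1%R, 2%R]) f t)%E); last first.
    apply: ge0_subset_integral => //; first exact: mf.
    by move=> t /=; rewrite !in_itv/= andbT => /andP[t1 _]; exact: lt_le_trans t1.
  apply: (@le_trans _ _ (\int[mu]_(t in `[1%R, 2%R]) (cst (expR (-2))%:E) t)%E).
    rewrite integral_cst//= lebesgue_measure_itv/= lte_fin ltr1n -EFinB.
    by rewrite -EFinM (_ : 2 - 1 = 1) ?mulr1//; lra.
  apply: ge0_le_integral => //.
  - by move=> t _; rewrite lee_fin expR_ge0.
  - exact: mf.
  move=> t /=; rewrite in_itv/= => /andP[t1 t2]; rewrite lee_fin.
  rewrite powR_mulrn; last by lra.
  rewrite -[leLHS]mul1r ler_pM ?expR_ge0// ?exprn_ege1// ler_expR; lra.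
have h0 : 0 < 2^-1 :> R by rewrite invr_gt0.
pose C : R := 2 ^+ k.+2 * (k.+1)`!%:R.
have C0 : 0 <= C by rewrite mulr_ge0// exprn_ge0.
pose g t := (exponential_pdf (2^-1 : R) t)%:E.
have mg (D : set R) : measurable_fun D g.
  by apply/measurable_EFinP; apply: measurable_funTS; exact: measurable_exponential_pdf.
have g0 t : (0 <= g t)%E by rewrite lee_fin exponential_pdf_ge0// ltW.
have up : (\int[mu]_(t in `]0%R, +oo[) f t <= C%:E)%E.
  apply: (@le_trans _ _ (\int[mu]_(t in `]0%R, +oo[) (C%:E * g t))%E).
    apply: ge0_le_integral => //.
    - exact: mf.
    - by apply: measurable_funeM; exact: mg.
    move=> t /=; rewrite in_itv/= andbT => t0.
    rewrite /f /g -EFinM lee_fin (exponential_pdfE _ (ltW t0)) (powR_mulrn _ (ltW t0)).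
    (* Half of the exponential absorbs the power of t. *)
    have -> : - t = - 2^-1 * t + - (t / 2) by lra.
    rewrite expRD expRN.
    have th : 0 <= t / 2 by rewrite divr_ge0// ltW.
    have e1 := expR_ge1Dxn k th.
    set E := expR (t / 2) in e1 *; set W := expR (- 2^-1 * t).
    have W0 : 0 <= W by exact: expR_ge0.
    have E0 : 0 < E by exact: expR_gt0.
    have F0 : 0 < (k.+1)`!%:R :> R by rewrite ltr0n fact_gt0.
    have te : t ^+ k.+1 <= 2 ^+ k.+1 * (k.+1)`!%:R * E.
      have : (t / 2) ^+ k.+1 / (k.+1)`!%:R <= E by lra.
      by rewrite ler_pdivrMr// expr_div_n ler_pdivrMr ?exprn_gt0//; lra.
    have -> : C * (2^-1 * W) = (2 ^+ k.+1 * (k.+1)`!%:R) * W.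
      by rewrite /C [2 ^+ k.+2]exprS; field.
    rewrite mulrCA [leRHS]mulrC; apply: ler_wpM2l => //.
    by rewrite ler_pdivrMr.
  rewrite ge0_integralZl//; last exact: mg.
  rewrite -[leRHS]mule1 lee_wpmul2l ?lee_fin//.
  rewrite -(integral_exponential_pdf h0).
  by apply: ge0_subset_integral => //; exact: mg.
rewrite fine_gt0//; apply/andP; split.
  by apply: lt_le_trans lo; rewrite lte_fin expR_gt0.
by apply: le_lt_trans up _; rewrite ltry.
Qed.
End gamma.

(** * Moments of independent sums *)

Section independent_sums.
Context d (T : measurableType d) (R : realType) (P : probability T R).
Variables (Y : T -> R) (m : nat -> R).
Hypothesis mY : measurable_fun setT Y.

Definition has_moments (K : nat) := forall k, (k <= K)%N ->
  P.-integrable setT (fun x => (Y x ^+ k)%:E) /\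
  (\int[P]_x (Y x ^+ k)%:E = (m k)%:E)%E.

Lemma integral_poly_moments (K : nat) (c : nat -> R) : has_moments K ->
  (\int[P]_x (\sum_(k < K.+1) c k * Y x ^+ k)%:E = (\sum_(k < K.+1) c k * m k)%:E)%E.
Proof.
move=> Ym; under eq_integral do rewrite -sumEFin.
rewrite integral_sum//; last first.
  move=> k; have [iY _] := Ym k (leq_ord k).
  under eq_fun do rewrite EFinM.
  exact: integrableZl.
rewrite -sumEFin; apply: eq_bigr => k _; have [iY YE] := Ym k (leq_ord k).
under eq_integral do rewrite EFinM.
by rewrite integralZl// YE -EFinM.
Qed.

Definition wsum n (a : 'I_n -> R) (w : n.-tuple T) : R := \sum_i a i * Y (tnth w i).

Lemma measurable_wsum n (a : 'I_n -> R) : measurable_fun setT (wsum a).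
Proof.
apply: measurable_sum => i; apply: measurable_funM => //.
by apply: measurableT_comp => //; exact: measurable_tnth.
Qed.

Lemma measurable_shifted_wsum n (a : 'I_n -> R) b :
  measurable_fun setT (fun w => b + wsum a w).
Proof. by apply: measurable_funD => //; exact: measurable_wsum. Qed.

Lemma wsum_tcons n (a : 'I_n.+1 -> R) x (w : n.-tuple T) :
  wsum a (tcons (x, w)) = a ord0 * Y x + wsum (fun i => a (lift ord0 i)) w.
Proof.
rewrite /wsum big_ord_recl; congr (_ + _).
by apply: eq_bigr => i _; rewrite tnthS.
Qed.

(** The first of the [n + 1] copies is integrated last, so that it can be
    merged into the shift [b]; this makes the moments below inductions on [n]
    with [b] generalized. *)
Lemma integral_power_probS n (F : R -> R) (a : 'I_n.+1 -> R) (b : R) :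
  measurable_fun setT F -> (forall x, 0 <= F x) ->
  (\int[power_prob P n.+1]_w (F (b + wsum a w))%:E =
   \int[P]_x \int[power_prob P n]_w
      (F ((b + a ord0 * Y x)%R + wsum (fun i => a (lift ord0 i)) w))%:E)%E.
Proof.
move=> mF F0.
have mg : measurable_fun setT (fun w => (F (b + wsum a w))%:E).
  apply/measurable_EFinP; apply: measurableT_comp => //.
  exact: measurable_shifted_wsum.
rewrite /= ge0_integral_distribution//; last by move=> w; rewrite lee_fin.
rewrite fubini_tonelli1; last 2 first.
- apply: measurableT_comp => //; exact: measurable_tcons.
- by move=> z; rewrite lee_fin.
apply: eq_integral => x _; apply: eq_integral => w _ /=.
by rewrite /fubini_F /= wsum_tcons addrA.
Qed.

Lemma second_moment_wsum n (a : 'I_n -> R) (b : R) :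
  has_moments 2 -> m 0 = 1 -> m 1 = 0 ->
  (\int[power_prob P n]_w ((b + wsum a w) ^+ 2)%:E =
   (b ^+ 2 + m 2 * \sum_i a i ^+ 2)%:E)%E.
Proof.
move=> Ym m0 m1; elim: n a b => [|n IH] a b.
  rewrite integral_dirac//=; last first.
    apply/measurable_EFinP; apply: measurable_funX.
    exact: measurable_shifted_wsum.
  by rewrite diracE in_setT mul1e /wsum !big_ord0; congr EFin; ring.
rewrite (@integral_power_probS _ (fun x => x ^+ 2)) => [||x]; last 2 first.
- exact: measurable_funX.
- exact: sqr_ge0.
rewrite big_ord_recl; set A2 := \sum_(i < n) _.
pose c (k : nat) := [:: b ^+ 2 + m 2 * A2; 2 * b * a ord0; a ord0 ^+ 2]`_k.
transitivity (\int[P]_x (\sum_(k < 3) c k * Y x ^+ k)%:E)%E.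
  apply: eq_integral => x _; rewrite IH -/A2; congr EFin.
  by rewrite !big_ord_recl big_ord0 /c /=; ring.
rewrite integral_poly_moments// !big_ord_recl big_ord0 /c /= m0 m1.
by congr EFin; ring.
Qed.

Lemma fourth_moment_wsum n (a : 'I_n -> R) (b : R) :
  has_moments 4 -> m 0 = 1 -> m 1 = 0 ->
  (\int[power_prob P n]_w ((b + wsum a w) ^+ 4)%:E =
   (b ^+ 4 + 6 * b ^+ 2 * m 2 * (\sum_i a i ^+ 2) + 4 * b * m 3 * (\sum_i a i ^+ 3)
     + m 4 * (\sum_i a i ^+ 4)
     + 3 * m 2 ^+ 2 * ((\sum_i a i ^+ 2) ^+ 2 - \sum_i a i ^+ 4))%:E)%E.
Proof.
move=> Ym m0 m1; elim: n a b => [|n IH] a b.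
  rewrite integral_dirac//=; last first.
    apply/measurable_EFinP; apply: measurable_funX.
    exact: measurable_shifted_wsum.
  by rewrite diracE in_setT mul1e /wsum !big_ord0; congr EFin; ring.
rewrite (@integral_power_probS _ (fun x => x ^+ 4)) => [||x]; last 2 first.
- exact: measurable_funX.
- exact: exprn_even_ge0.
rewrite !(big_ord_recl n).
set A2 := \sum_(i < n) _ ^+ 2; set A3 := \sum_(i < n) _ ^+ 3; set A4 := \sum_(i < n) _ ^+ 4.
set a0 := a ord0.
(* The inner integral is a polynomial in Y x, with these coefficients. *)
pose c (k : nat) := [:: b ^+ 4 + 6 * b ^+ 2 * m 2 * A2 + 4 * b * m 3 * A3 + m 4 * A4
    + 3 * m 2 ^+ 2 * (A2 ^+ 2 - A4);
  4 * b ^+ 3 * a0 + 12 * b * a0 * m 2 * A2 + 4 * a0 * m 3 * A3;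
  6 * b ^+ 2 * a0 ^+ 2 + 6 * a0 ^+ 2 * m 2 * A2; 4 * b * a0 ^+ 3; a0 ^+ 4]`_k.
transitivity (\int[P]_x (\sum_(k < 5) c k * Y x ^+ k)%:E)%E.
  apply: eq_integral => x _; rewrite IH -/A2 -/A3 -/A4 -/a0; congr EFin.
  by rewrite !big_ord_recl big_ord0 /c /=; ring.
rewrite integral_poly_moments// !big_ord_recl big_ord0 /c /= m0 m1.
by congr EFin; ring.
Qed.

End independent_sums.

(** * The random vector norms for d = 2 and d = 4 *)

Section admissible_norms.
Context (d : measure_display) (T : measurableType d) (R : realType).
Context (P : probability T R) (X : {RV P >-> R}).

Definition mean : R := fine (\int[P]_x (X x)%:E).
Definition centered (x : T) : R := X x - mean.
Definition cmoment (k : nat) : R := fine (\int[P]_x (centered x ^+ k)%:E).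

Lemma measurable_centered : measurable_fun setT centered.
Proof. by apply: measurable_funB => //; exact: measurable_funP. Qed.

Lemma integrable_powers (K k : nat) : (k <= K)%N ->
  ('E_P[(fun w => `|X w| `^ K%:R)%R] < +oo)%E ->
  P.-integrable setT (fun x => (X x ^+ k)%:E).
Proof.
move=> kK; rewrite unlock => XK.
have mX : measurable_fun setT X by exact: measurable_funP.
have iK : P.-integrable setT (fun x => (X x ^+ K)%:E).
  apply/integrableP; split.
    by apply/measurable_EFinP; exact: measurable_funX.
  apply: le_lt_trans XK; rewrite le_eqVlt; apply/orP; left; apply/eqP.
  by apply: eq_integral => x _; rewrite /= normrX powR_mulrn.
have i1 : P.-integrable setT (fun x : T => (1 : R)%:E).
  exact: (finite_measure_integrable_cst P 1).
have := integrableD measurableT i1 (integrable_abse iK); apply: le_integrable => //.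
  by apply/measurable_EFinP; exact: measurable_funX.
move=> x _ /=; rewrite lee_fin !normrX; set u := `|X x|.
have u0 : 0 <= u by exact: normr_ge0.
rewrite ger0_norm; last by rewrite addr_ge0// exprn_ge0.
have [u1|u1] := leP u 1.
  by apply: (@le_trans _ _ 1); [exact: exprn_ile1|rewrite lerDl exprn_ge0].
apply: (@le_trans _ _ (u ^+ K)); last by rewrite lerDr.
by rewrite ler_eXn2l.
Qed.

Lemma centered_moments (K : nat) : 
  ('E_P[(fun w => `|X w| `^ K%:R)%R] < +oo)%E ->
  has_moments P centered cmoment K.
Proof.
move=> XK k kK.
have iY : P.-integrable setT (fun x => (centered x ^+ k)%:E).
  have -> : (fun x => (centered x ^+ k)%:E) =
      fun x => (\sum_(i < k.+1) (((- mean) ^+ i *+ 'C(k, i))%:E * (X x ^+ (k - i))%:E))%E.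
    apply/funext => x; rewrite /centered exprDn -sumEFin; apply: eq_bigr => i _.
    by rewrite -EFinM mulrnAl mulrC.
  apply: integrable_sum => // i _; apply: integrableZl => //.
  by apply: (@integrable_powers K) => //; exact: leq_trans (leq_subr _ _) kK.
split=> //; rewrite fineK//; exact: integrable_fin_num.
Qed.

Lemma cmoment0 : cmoment 0 = 1.
Proof.
rewrite /cmoment; under eq_integral do rewrite expr0.
by rewrite integral_cst//= probability_setT mule1.
Qed.

Lemma cmoment1 (K : nat) : (0 < K)%N ->
  ('E_P[(fun w => `|X w| `^ K%:R)%R] < +oo)%E -> cmoment 1 = 0.
Proof.
move=> K0 XK; have := integrable_powers K0 XK.
under eq_fun do rewrite expr1; move=> iX.
rewrite /cmoment; under eq_integral do rewrite expr1 /centered EFinB.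
rewrite integralB//; last exact: (finite_measure_integrable_cst P mean).
rewrite integral_cst//= probability_setT mule1 -(@fineK _ (\int[P]_x (X x)%:E)%E).
  by rewrite /= -/mean subrr.
exact: integrable_fin_num.
Qed.

(** A variable with zero variance is almost surely equal to its mean. *)
Lemma cmoment2_gt0 (K : nat) : (1 < K)%N ->
  ('E_P[(fun w => `|X w| `^ K%:R)%R] < +oo)%E ->
  ~ (exists a : R, {ae P, forall w, X w = a}) -> 0 < cmoment 2.
Proof.
move=> K1 XK nc; rewrite lt_neqAle andbC fine_ge0/=; last first.
  by apply: integral_ge0 => x _; rewrite lee_fin sqr_ge0.
apply/eqP => m2; apply: nc; exists mean.
have [iY YE] := centered_moments XK K1.
have mY := measurable_int _ iY.
have : (\int[P]_x `| (centered x ^+ 2)%:E | = 0)%E.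
  rewrite -[RHS]/(0%:E) m2 -YE; apply: eq_integral => x _.
  by rewrite gee0_abs// lee_fin sqr_ge0.
move=> /(ae_eq_integral_abs _ measurableT mY).
apply: filterS => x /(_ I) /= [] /eqP.
by rewrite sqrf_eq0 subr_eq0 => /eqP.
Qed.

(** This is the nonnegativity of the variance of the squared centered
    variable. *)
Lemma cmoment4_ge : ('E_P[(fun w => `|X w| `^ 4%:R)%R] < +oo)%E ->
  cmoment 2 ^+ 2 <= cmoment 4.
Proof.
move=> X4; have Ym := centered_moments X4.
(* The coefficients of (Y^2 - s)^2, for Y the centered variable. *)
pose s := cmoment 2; pose c (k : nat) := [:: s ^+ 2; 0; - 2 * s; 0; 1]`_k.
have := integral_poly_moments c Ym.
have : (0 <= \int[P]_x (\sum_(k < 5) c k * centered x ^+ k)%:E)%E.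
  apply: integral_ge0 => x _; rewrite lee_fin.
  rewrite (_ : \sum_(k < 5) _ = (centered x ^+ 2 - s) ^+ 2) ?sqr_ge0//.
  by rewrite !big_ord_recl big_ord0 /c /=; ring.
move=> h e; move: h; rewrite e lee_fin (_ : \sum_(k < 5) _ = cmoment 4 - s ^+ 2).
  by rewrite subr_ge0.
by rewrite !big_ord_recl big_ord0 /c /= cmoment0 /s; ring.
Qed.

(** The eigenvalues have sum zero, so the mean of [X] cancels. *)
Lemma sum_ev_centered n (G : sgraph n) (w : n.-tuple T) :
  \sum_(i < n) lambda R G i.+1 * X (tnth w i) = 0 + wsum centered (ev G) w.
Proof.
rewrite add0r /wsum /centered.
under [RHS]eq_bigr do rewrite mulrBr.
by rewrite sumrB -mulr_suml sum_ev0 mul0r subr0.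
Qed.

Lemma rv_norm2_pow4 : admissible X 2 -> exists2 g : R, 0 < g &
  forall n (G : sgraph n), rv_norm X 2 G ^+ 4 = g * ck R 2 G ^+ 2.
Proof.
move=> [_ nc X2].
have Ym := centered_moments (K := 2) X2; have m1 := cmoment1 (K := 2) isT X2.
have s0 := cmoment2_gt0 (K := 2) isT X2 nc; set s := cmoment 2 in s0.
exists (Gamma (2 + 1) `^ (- 2^-1) ^+ 4 * s ^+ 2).
  by rewrite mulr_gt0 ?exprn_gt0// powR_gt0// (Gamma_natr_gt0 1).
move=> n G; rewrite /rv_norm exprMn -mulrA; congr (_ * _).
have -> : 'E_(power_prob P n)[fun w => (`|\sum_(i < n) lambda R G i.+1 * X (tnth w i)| `^ 2)%R]%E =
    (s * ck R 2 G)%:E.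
  rewrite unlock; transitivity (\int[power_prob P n]_w ((0 + wsum centered (ev G) w) ^+ 2)%:E)%E.
    apply: eq_integral => w _ /=; rewrite sum_ev_centered (powR_mulrn 2)// -normrX ger0_norm//.
    exact: sqr_ge0.
  rewrite (second_moment_wsum measurable_centered _ _ Ym cmoment0 m1) -ckE.
  by rewrite expr0n add0r.
have sc0 : 0 <= s * ck R 2 G by rewrite mulr_ge0 ?ck_ge0// ltW.
by rewrite /= powR12_sqrt// (exprM _ 2 2) sqr_sqrtr// exprMn.
Qed.

(** The normalized fourth moment minus one; it vanishes for random signs. *)
Definition excess : R := cmoment 4 / cmoment 2 ^+ 2 - 1.

Lemma rv_norm4_pow4 : admissible X 4 -> exists2 g : R, 0 < g &
  0 <= excess /\
  forall n (G : sgraph n), rv_norm X 4 G ^+ 4 =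
    g * (excess * ck R 4 G + (3 * ck R 2 G ^+ 2 - 2 * ck R 4 G)).
Proof.
move=> [_ nc X4].
have Ym := centered_moments (K := 4) X4; have m1 := cmoment1 (K := 4) isT X4.
have s0 := cmoment2_gt0 (K := 4) isT X4 nc; have m4 := cmoment4_ge X4.
set s := cmoment 2 in s0 m4.
exists (Gamma (4 + 1) `^ (- 4^-1) ^+ 4 * s ^+ 2).
  by rewrite mulr_gt0 ?exprn_gt0// powR_gt0// (Gamma_natr_gt0 3).
split=> [|n G]; first by rewrite /excess subr_ge0 ler_pdivlMr ?mul1r ?exprn_gt0.
rewrite /rv_norm exprMn -mulrA; congr (_ * _).
have EE : 'E_(power_prob P n)[fun w => (`|\sum_(i < n) lambda R G i.+1 * X (tnth w i)| `^ 4)%R]%E =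
    (s ^+ 2 * (excess * ck R 4 G + (3 * ck R 2 G ^+ 2 - 2 * ck R 4 G)))%:E.
  rewrite unlock; transitivity (\int[power_prob P n]_w ((0 + wsum centered (ev G) w) ^+ 4)%:E)%E.
    apply: eq_integral => w _ /=; rewrite sum_ev_centered (powR_mulrn 4)// -normrX ger0_norm//.
    exact: exprn_even_ge0.
  rewrite (fourth_moment_wsum measurable_centered _ _ Ym cmoment0 m1) -!ckE -/s.
  by congr EFin; rewrite /excess -/s; field; rewrite gt_eqF.
have E0 : 0 <= s ^+ 2 * (excess * ck R 4 G + (3 * ck R 2 G ^+ 2 - 2 * ck R 4 G)).
  by rewrite -lee_fin -EE; apply: expectation_ge0 => w; exact: powR_ge0.
by rewrite EE /= -(powR_mulrn 4) ?powR_ge0// -powRrM mulVf// powRr1.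
Qed.

End admissible_norms.

(** * Suprema and infima of the ratios *)

Section bernoulli_variable.
Context {R : realType}.

Definition indicator_true (b : bool) : R := b%:R.

Lemma measurable_indicator_true : measurable_fun setT indicator_true.
Proof. by move=> _ B _. Qed.

HB.instance Definition _ := isMeasurableFun.Build _ _ _ _
  indicator_true measurable_indicator_true.

Variable p : R.
Hypothesis p01 : 0 < p < 1.
Let P : probability bool R := bernoulli_prob p.
Let B : {RV P >-> R} := indicator_true.

Let p01_le : 0 <= p <= 1.
Proof. by case/andP: p01 => p0 p1; rewrite !ltW. Qed.

Lemma bernoulli_integral (f : R -> R) : (forall x, 0 <= f x) ->
  (\int[P]_b (f (B b))%:E = (p * f 1 + (1 - p) * f 0)%:E)%E.
Proof.
by move=> f0; rewrite integral_bernoulli_prob// => b; rewrite lee_fin.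
Qed.

Lemma bernoulli_admissible : admissible B 4.
Proof.
have /andP[p0 p1] := p01.
split; first by right.
  move=> [a [A [mA PA0 sA]]].
  have := bernoulli_probE p01_le A; rewrite [LHS]PA0 !diracE -!EFinM -EFinD => -[hA].
  have nA b : b \notin A -> B b = a.
    by move=> bA; apply: contrapT => Bb; move/negP: bA; apply; rewrite inE; exact: sA.
  have [tA fA] : true \notin A /\ false \notin A.
    have {}hA : 0 = p * (true \in A)%:R + (1 - p) * (false \in A)%:R by exact: hA.
    by move: hA; case: (true \in A); case: (false \in A) => /=; split=> //; lra.
  have h1 := nA _ tA; have h0 := nA _ fA.
  by move: h1; rewrite -h0 => /eqP; rewrite /B/= oner_eq0.
rewrite unlock (bernoulli_integral (f := fun x => `|x| `^ 4)) ?ltry//.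
Qed.

Lemma bernoulli_excess : excess B = (p * (1 - p))^-1 - 4.
Proof.
have /andP[p0 p1] := p01.
have me : mean B = p.
  rewrite /mean (_ : (\int[P]_x (B x)%:E = \int[P]_x (`|B x|)%:E)%E).
    by rewrite (bernoulli_integral (f := fun x => `|x|))//= normr1 normr0; ring.
  by apply: eq_integral => -[] _; rewrite /B/= ?normr1 ?normr0.
rewrite /excess /cmoment /centered me.
rewrite (bernoulli_integral (f := fun x => (x - p) ^+ 4)); last by move=> x; exact: exprn_even_ge0.
rewrite (bernoulli_integral (f := fun x => (x - p) ^+ 2)); last by move=> x; exact: sqr_ge0.
rewrite /= (_ : p * (1 - p) ^+ 2 + (1 - p) * (0 - p) ^+ 2 = p * (1 - p)); last by ring.
by field; rewrite !gt_eqF//; lra.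
Qed.

End bernoulli_variable.

Section ratios.
Context {R : realType} (a : R) (n m : nat) (G : sgraph n) (H : sgraph m).
Local Notation F K := (3 * ck R 2 K ^+ 2 - 2 * ck R 4 K).
Hypotheses (H4 : 0 < ck R 4 H) (HF : 0 < F H).

(** The fourth power of the ratio for a variable of [excess] [t]; the common
    factor coming from the variance and the gamma function cancels. *)
Definition ratio4 (t : R) : R := a ^+ 4 * ((t * ck R 4 G + F G) / (t * ck R 4 H + F H)).

Lemma expr4_quotient (b u v : R) : (b * u / v) ^+ 4 = b ^+ 4 * (u ^+ 4 / v ^+ 4).
Proof. by rewrite !exprMn exprVn mulrA. Qed.

(** For [p = 2] the value [t = 2] works, since
    [2 c4 + (3 c2^2 - 2 c4) = 3 c2^2]. *)
Lemma ratios4P y : ratios4 a G H y -> exists2 t, 0 <= t & y = (ratio4 t)%:E.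
Proof.
have den t : 0 <= t -> t * ck R 4 H + F H != 0.
  by move=> t0; rewrite gt_eqF// ltr_wpDl// mulr_ge0// ltW.
move=> [d [T [P [X [p [Xp ->]]]]]]; have [[p2|p4] _ _] := Xp.
  rewrite p2 in Xp *; have [g g0 gE] := rv_norm2_pow4 Xp.
  exists 2 => //; congr EFin; rewrite expr4_quotient !gE /ratio4.
  have -> : 2 * ck R 4 G + F G = 3 * ck R 2 G ^+ 2 by ring.
  have h := den 2 (ler0n _ _); move: h.
  have -> : 2 * ck R 4 H + F H = 3 * ck R 2 H ^+ 2 by ring.
  by rewrite mulf_eq0 negb_or sqrf_eq0 => /andP[_ h]; field; rewrite h gt_eqF.
rewrite p4 in Xp *; have [g g0 [t0 gE]] := rv_norm4_pow4 Xp.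
exists (excess X) => //; congr EFin; rewrite expr4_quotient !gE /ratio4.
by have h := den _ t0; field; rewrite h gt_eqF.
Qed.

Lemma ratios4_bernoulli (p : R) : 0 < p < 1 ->
  ratios4 a G H (ratio4 ((p * (1 - p))^-1 - 4))%:E.
Proof.
move=> p01; have adm := bernoulli_admissible p01.
have [g g0 [t0 gE]] := rv_norm4_pow4 adm.
exists _, bool, (bernoulli_prob p), indicator_true, 4; split => //.
congr EFin; rewrite -(bernoulli_excess p01) expr4_quotient !gE /ratio4.
have h : excess (indicator_true : {RV (bernoulli_prob p) >-> R}) * ck R 4 H + F H != 0.
  by rewrite gt_eqF// ltr_wpDl// mulr_ge0// ltW.
by field; rewrite h gt_eqF.
Qed.

Local Notation x := (ck R 4 G / ck R 4 H).
Local Notation y := (F G / F H).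

Lemma ratios4_rademacher : ratios4 a G H (a ^+ 4 * y)%:E.
Proof.
have := ratios4_bernoulli (p := 2^-1); rewrite /ratio4.
have -> : (2^-1 * (1 - 2^-1))^-1 - 4 = 0 :> R by field.
by rewrite !mul0r !add0r; apply; rewrite invr_gt0 invf_lt1 ?ltr1n ltr0n.
Qed.

(** As [p] tends to zero the [excess] tends to infinity, and the mediant tends
    to the quotient of the fourth power sums; [M] is the value of [t] from
    which the distance to the limit is below [e]. *)
Lemma ratios4_sparse (e : R) : 0 < e ->
  exists2 z, ratios4 a G H z%:E & `|z - a ^+ 4 * x| < e.
Proof.
move=> e0.
pose C := `|a ^+ 4 * (F G * ck R 4 H - ck R 4 G * F H)|.
pose M := C / (e * ck R 4 H ^+ 2).
have M0 : 0 <= M by rewrite divr_ge0 ?normr_ge0// mulr_ge0 ?sqr_ge0// ltW.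
pose p := (M + 6)^-1; have q0 : 0 < M + 6 by lra.
have p0 : 0 < p by rewrite invr_gt0.
have p6 : p <= 6^-1 by rewrite lef_pV2 ?posrE//; lra.
have p01 : 0 < p < 1 by rewrite p0/= (le_lt_trans p6)// invf_lt1// ltr1n.
pose t := (p * (1 - p))^-1 - 4.
have tM : M < t.
  have : p^-1 <= (p * (1 - p))^-1 by rewrite lef_pV2 ?posrE ?mulr_gt0//; nra.
  by rewrite /p invrK -/p /t; lra.
exists (ratio4 t); first exact: ratios4_bernoulli.
have D0 : 0 < t * ck R 4 H + F H.
  by rewrite ltr_wpDl// mulr_ge0 ?ltW//; apply: le_lt_trans tM.
rewrite (_ : _ - _ = a ^+ 4 * (F G * ck R 4 H - ck R 4 G * F H) /
  (ck R 4 H * (t * ck R 4 H + F H))); last first.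
  by rewrite /ratio4; field; rewrite !gt_eqF.
have DD0 : 0 < ck R 4 H * (t * ck R 4 H + F H) by rewrite mulr_gt0.
rewrite normrM normfV (gtr0_norm DD0) -/C ltr_pdivrMr//.
have e4 : 0 < e * ck R 4 H ^+ 2 by rewrite mulr_gt0// exprn_gt0.
move: tM; rewrite ltr_pdivrMr// => h; apply: lt_le_trans h _.
have : 0 <= e * (ck R 4 H * F H) by rewrite mulr_ge0 ?mulr_ge0// ltW.
by lra.
Qed.

Lemma ratio4_between t : 0 <= t ->
  a ^+ 4 * Num.min x y <= ratio4 t <= a ^+ 4 * Num.max x y.
Proof.
move=> t0; have /andP[h1 h2] := mediant_between (ck R 4 G) (F G) t0 H4 HF.
have a4 : 0 <= a ^+ 4 by exact: exprn_even_ge0.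
by rewrite /ratio4 !ler_wpM2l.
Qed.

Lemma ereal_sup_ratios4 : ereal_sup (ratios4 a G H) = (a ^+ 4 * Num.max x y)%:E.
Proof.
apply/eqP; rewrite eq_le; apply/andP; split.
  apply: ge_ereal_sup => z /ratios4P[t t0 ->].
  by rewrite lee_fin; case/andP: (ratio4_between t0).
rewrite maxEle; case: ifP => _.
  by apply: ereal_sup_ubound; exact: ratios4_rademacher.
apply/lee_addgt0Pr => e e0; have [z zr ze] := ratios4_sparse e0.
apply: (@le_trans _ _ (z%:E + e%:E)%E); last by rewrite leeD2r// ereal_sup_ubound.
by rewrite -EFinD lee_fin; move: ze; rewrite ltr_norml => /andP[]; lra.
Qed.

Lemma ereal_inf_ratios4 : ereal_inf (ratios4 a G H) = (a ^+ 4 * Num.min x y)%:E.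
Proof.
apply/eqP; rewrite eq_le; apply/andP; split; last first.
  apply: le_ereal_inf_tmp => z /ratios4P[t t0 ->].
  by rewrite lee_fin; case/andP: (ratio4_between t0).
rewrite minElt; case: ifP => _; last first.
  by apply: ereal_inf_lbound; exact: ratios4_rademacher.
apply/lee_addgt0Pr => e e0; have [z zr ze] := ratios4_sparse e0.
apply: (@le_trans _ _ z%:E); first exact: ereal_inf_lbound.
by rewrite -EFinD lee_fin; move: ze; rewrite ltr_norml => /andP[]; lra.
Qed.

End ratios.

(** * Best constants and equality cases *)

Section comparisons.
Context {R : realType}.

Lemma fraction_le (c2 c4 h2 h4 : R) : 0 < h4 -> 0 < 3 * h2 ^+ 2 - 2 * h4 ->
  c2 ^+ 2 * h4 <= h2 ^+ 2 * c4 ->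
  (3 * c2 ^+ 2 - 2 * c4) / (3 * h2 ^+ 2 - 2 * h4) <= c4 / h4.
Proof.
by move=> h40 hF h; rewrite ler_pdivrMr// mulrAC ler_pdivlMr//; lra.
Qed.

Lemma fraction_ge (c2 c4 h2 h4 : R) : 0 < h4 -> 0 < 3 * h2 ^+ 2 - 2 * h4 ->
  h2 ^+ 2 * c4 <= c2 ^+ 2 * h4 ->
  c4 / h4 <= (3 * c2 ^+ 2 - 2 * c4) / (3 * h2 ^+ 2 - 2 * h4).
Proof.
by move=> h40 hF h; rewrite ler_pdivrMr// mulrAC ler_pdivlMr//; lra.
Qed.

Lemma expr4N (x : R) : (- x) ^+ 4 = x ^+ 4.
Proof. ring. Qed.

Lemma pos_part0 (x : R) : pos_part (x ^+ 2 - x * x) = 0.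
Proof. by rewrite /pos_part expr2 subrr maxxx. Qed.

Lemma complete_fourth_power (N : R) : 2 <= N ->
  (N - 1) ^+ 4 = N * (N - 1) * (N ^+ 2 - 3 * N + 3) / (1 + (N - 1) ^- 3).
Proof.
move=> N2; have N1 : 0 < N - 1 by lra.
have N3 : 0 < (N - 1) ^+ 3 by exact: exprn_gt0.
by field; apply/andP; split; rewrite gt_eqF//; lra.
Qed.

Lemma complete_rad4_positive (N : R) : 2 <= N ->
  0 < N * (N - 1) * (N ^+ 2 + 3 * N - 6).
Proof.
move=> N2; have sq : 0 <= (N - 2) * N by rewrite mulr_ge0//; lra.
by apply: mulr_gt0; [apply: mulr_gt0|]; lra.
Qed.

Lemma complete_ck4_positive (N : R) : 2 <= N ->
  0 < N * (N - 1) * (N ^+ 2 - 3 * N + 3).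
Proof.
move=> N2; have sq : 0 <= (N - 2) * (N - 1) by rewrite mulr_ge0//; lra.
by apply: mulr_gt0; [apply: mulr_gt0|]; lra.
Qed.

Lemma matching_scaling (r g : R) : 1 <= r ->
  (2 * r) ^+ 4 * (g / (12 * r ^+ 2 - 4 * r)) = 4 * r ^+ 3 * g / (3 * r - 1).
Proof. by move=> r1; field; apply/andP; split; rewrite gt_eqF//; nra. Qed.

Lemma min_pos_part (u v : R) :
  Num.min (u / 2) ((3 * v - 2 * u) / 8) = (4 * u - 3 * pos_part (2 * u - v)) / 8.
Proof. by rewrite /pos_part minEle maxEle; case: ifP; case: ifP => *; lra. Qed.

Lemma max_pos_part (u v : R) :
  2 ^+ 4 * Num.max (u / 2) ((3 * v - 2 * u) / 8) = 8 * u + 6 * pos_part (v - 2 * u).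
Proof. by rewrite /pos_part !maxEle; case: ifP; case: ifP => *; lra. Qed.

End comparisons.

Section ratio_bounds.
Context {R : realType} {n : nat} (n_gt0 : (0 < n)%N) (G : sgraph n.+1).
Local Notation rho := ((n.+1)./2%:R : R).
Local Notation N := (n.+1%:R : R).
Local Notation M := (matching_graph n.+1).
Local Notation K := (complete_graph n.+1).
Local Notation c2 := (ck R 2 G).
Local Notation c4 := (ck R 4 G).
Local Notation F H := (3 * ck R 2 H ^+ 2 - 2 * ck R 4 H).

Lemma size_ge2 : 2 <= N.
Proof. by rewrite (ler_nat _ 2). Qed.

Lemma matching_rad4 : F M = 12 * rho ^+ 2 - 4 * rho.
Proof. by rewrite ck2_matching_graph ck4_matching_graph; ring. Qed.

Lemma matching_rad4_gt0 : 0 < F M.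
Proof. by rewrite matching_rad4; have := half_size_ge1 (R := R) n_gt0; nra. Qed.

Lemma matching_ck4_gt0 : 0 < ck R 4 M.
Proof. by rewrite ck4_matching_graph; have := half_size_ge1 (R := R) n_gt0; lra. Qed.

Lemma ratio_matching_le : F G / F M <= c4 / ck R 4 M.
Proof.
apply: fraction_le; [exact: matching_ck4_gt0|exact: matching_rad4_gt0|].
rewrite ck2_matching_graph ck4_matching_graph expr2.
rewrite [leLHS]mulrC -[leRHS]mulrA ler_wpM2l//.
exact: ck2_sqr_le.
Qed.

Lemma complete_rad4 : F K = N * (N - 1) * (N ^+ 2 + 3 * N - 6).
Proof. by rewrite ck2_complete ck4_complete; ring. Qed.

Lemma complete_rad4_gt0 : 0 < F K.
Proof. by rewrite complete_rad4 complete_rad4_positive// size_ge2. Qed.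

Lemma complete_ck4_gt0 : 0 < ck R 4 K.
Proof. by rewrite ck4_complete complete_ck4_positive// size_ge2. Qed.

Lemma ratio_complete_le : c4 / ck R 4 K <= F G / F K.
Proof.
apply: fraction_ge; [exact: complete_ck4_gt0|exact: complete_rad4_gt0|].
by rewrite ck2_complete ck4_complete mulrC; exact: c4_le.
Qed.

Lemma sup_matching : ereal_sup (ratios4 1 G M) = (c4 / (2 * rho))%:E.
Proof.
rewrite (ereal_sup_ratios4 1 G matching_ck4_gt0 matching_rad4_gt0).
by rewrite expr1n mul1r (max_l ratio_matching_le) ck4_matching_graph.
Qed.

Lemma inf_matching :
  ereal_inf (ratios4 1 G M) = (F G / (12 * rho ^+ 2 - 4 * rho))%:E.
Proof.
rewrite (ereal_inf_ratios4 1 G matching_ck4_gt0 matching_rad4_gt0).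
rewrite expr1n mul1r (min_r ratio_matching_le).
by congr (_ / _)%:E; exact: matching_rad4.
Qed.

Lemma inf_scaled_matching : ereal_inf (ratios4 (2 * rho) G M) =
  (4 * rho ^+ 3 * F G / (3 * rho - 1))%:E.
Proof.
rewrite (ereal_inf_ratios4 _ G matching_ck4_gt0 matching_rad4_gt0).
rewrite (min_r ratio_matching_le).
have -> : F G / F M = F G / (12 * rho ^+ 2 - 4 * rho).
  by congr (_ / _); exact: matching_rad4.
by rewrite matching_scaling//; exact: half_size_ge1.
Qed.

Lemma inf_complete : ereal_inf (ratios4 (N - 1) G K) =
  (c4 / (1 + (N - 1) ^- 3))%:E.
Proof.
rewrite (ereal_inf_ratios4 _ G complete_ck4_gt0 complete_rad4_gt0).
rewrite (min_l ratio_complete_le); congr EFin.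
have := ck4_complete (R := R) (n := n); have := complete_fourth_power size_ge2.
have := complete_ck4_gt0.
move: (ck R 4 K) c4 => k g k0 h kE; rewrite h -kE mulrC -mulrA; congr (_ * _).
by rewrite mulKf// gt_eqF.
Qed.

Lemma sup_complete : ereal_sup (ratios4 1 G K) =
  (F G / (N * (N - 1) * (N ^+ 2 + 3 * N - 6)))%:E.
Proof.
rewrite (ereal_sup_ratios4 _ G complete_ck4_gt0 complete_rad4_gt0).
rewrite expr1n mul1r (max_r ratio_complete_le).
by congr (_ / _)%:E; exact: complete_rad4.
Qed.

Section complete_bipartite_ratios.
Variables (r s : nat).
Hypotheses (r_gt0 : (0 < r)%N) (s_gt0 : (0 < s)%N).
Local Notation H := (complete_bipartite r s).
Local Notation q := (Num.sqrt (r%:R * s%:R) : R).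

Lemma complete_bipartite_ck4_gt0 : 0 < ck R 4 H.
Proof. by rewrite ck4_complete_bipartite mulr_gt0// exprn_gt0// mulr_gt0// ltr0n. Qed.

Lemma complete_bipartite_rad4 : F H = 8 * (r%:R * s%:R) ^+ 2.
Proof. by rewrite ck2_complete_bipartite ck4_complete_bipartite; ring. Qed.

Lemma complete_bipartite_rad4_gt0 : 0 < F H.
Proof. by rewrite complete_bipartite_rad4 mulr_gt0// exprn_gt0// mulr_gt0// ltr0n. Qed.

Lemma sqrt_pow4 : q ^+ 4 = (r%:R * s%:R) ^+ 2.
Proof. by rewrite (exprM _ 2 2) sqr_sqrtr// mulr_ge0. Qed.

Lemma scaled_ck4 : q ^+ 4 * (c4 / ck R 4 H) = c4 / 2.
Proof.
rewrite sqrt_pow4 ck4_complete_bipartite.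
have : (r%:R * s%:R) ^+ 2 != 0 :> R by rewrite expf_neq0// mulf_neq0// pnatr_eq0 -lt0n.
by move: (_ ^+ 2) c4 => x c x0; field.
Qed.

Lemma scaled_rad4 : q ^+ 4 * (F G / F H) = F G / 8.
Proof.
rewrite sqrt_pow4 complete_bipartite_rad4.
have : (r%:R * s%:R) ^+ 2 != 0 :> R by rewrite expf_neq0// mulf_neq0// pnatr_eq0 -lt0n.
by move: (_ ^+ 2) (F G) => x c x0; field.
Qed.

Lemma inf_complete_bipartite : ereal_inf (ratios4 q G H) =
  ((4 * c4 - 3 * pos_part (2 * c4 - c2 ^+ 2)) / 8)%:E.
Proof.
rewrite (ereal_inf_ratios4 _ G complete_bipartite_ck4_gt0 complete_bipartite_rad4_gt0).
rewrite minr_pMr; last by rewrite sqrt_pow4 sqr_ge0.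
by rewrite scaled_ck4 scaled_rad4 min_pos_part.
Qed.

Lemma sup_complete_bipartite : ereal_sup (ratios4 (2 * q) G H) =
  (8 * c4 + 6 * pos_part (c2 ^+ 2 - 2 * c4))%:E.
Proof.
rewrite (ereal_sup_ratios4 _ G complete_bipartite_ck4_gt0 complete_bipartite_rad4_gt0).
rewrite exprMn -mulrA maxr_pMr; last by rewrite sqrt_pow4 sqr_ge0.
by rewrite scaled_ck4 scaled_rad4 max_pos_part.
Qed.

End complete_bipartite_ratios.

Lemma lam1_le_bipartite : bipartite G -> ev G ord0 ^+ 4 <=
  (4 * c4 - 3 * pos_part (2 * c4 - c2 ^+ 2)) / 8.
Proof. by move=> bG; rewrite -expr4N -lamn_bipartite//; exact: lamn_le. Qed.

End ratio_bounds.

Section equality_cases.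
Context {R : realType} {n : nat} (n_gt0 : (0 < n)%N).
Local Notation rho := ((n.+1)./2%:R : R).
Local Notation N := (n.+1%:R : R).
Local Notation M := (matching_graph n.+1).
Local Notation K := (complete_graph n.+1).
Local Notation E := (single_edge n.+1).

Lemma matching_lam1 : ck R 4 M / (2 * rho) = ev M ord0 ^+ 4.
Proof.
rewrite ck4_matching_graph (ev0_matching_graph n_gt0) expr1n divff// gt_eqF//.
by have := half_size_ge1 (R := R) n_gt0; lra.
Qed.

Lemma matching_beta : beta R M ^+ 4 =
  (3 * ck R 2 M ^+ 2 - 2 * ck R 4 M) / (12 * rho ^+ 2 - 4 * rho).
Proof.
have := matching_rad4_gt0 (R := R) n_gt0; rewrite matching_rad4 => h.
by rewrite (beta_matching_graph n_gt0) expr1n divff// gt_eqF.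
Qed.

Lemma matching_energy : energy R M ^+ 4 =
  4 * rho ^+ 3 * (3 * ck R 2 M ^+ 2 - 2 * ck R 4 M) / (3 * rho - 1).
Proof.
rewrite energy_matching_graph matching_rad4.
have := half_size_ge1 (R := R) n_gt0; move: rho => r r1.
by field; rewrite gt_eqF//; lra.
Qed.

Lemma complete_lam1 : ev K ord0 ^+ 4 = ck R 4 K / (1 + (N - 1) ^- 3).
Proof.
by rewrite ev0_complete ck4_complete; exact/complete_fourth_power/size_ge2.
Qed.

Lemma complete_lamn : (3 * ck R 2 K ^+ 2 - 2 * ck R 4 K) /
  (N * (N - 1) * (N ^+ 2 + 3 * N - 6)) = ev K ord_max ^+ 4.
Proof.
rewrite complete_rad4 (evn_complete n_gt0) expr4N expr1n divff// gt_eqF//.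
exact/complete_rad4_positive/size_ge2.
Qed.

Lemma single_edge_energy :
  8 * ck R 4 E + 6 * pos_part (ck R 2 E ^+ 2 - 2 * ck R 4 E) = energy R E ^+ 4.
Proof.
rewrite (energy_single_edge n_gt0) (ck2_single_edge n_gt0) (ck4_single_edge n_gt0).
by rewrite pos_part0; ring.
Qed.

Lemma single_edge_bound :
  (4 * ck R 4 E - 3 * pos_part (2 * ck R 4 E - ck R 2 E ^+ 2)) / 8 = 1.
Proof.
rewrite (ck2_single_edge n_gt0) (ck4_single_edge n_gt0).
by rewrite -[2 ^+ 2]/(2 * 2) subrr /pos_part maxxx; field.
Qed.

Lemma single_edge_lam1 : ev E ord0 ^+ 4 =
  (4 * ck R 4 E - 3 * pos_part (2 * ck R 4 E - ck R 2 E ^+ 2)) / 8.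
Proof. by rewrite single_edge_bound (ev0_single_edge n_gt0) expr1n. Qed.

Lemma single_edge_lamn : ev E ord_max ^+ 4 =
  (4 * ck R 4 E - 3 * pos_part (2 * ck R 4 E - ck R 2 E ^+ 2)) / 8.
Proof. by rewrite single_edge_bound (evn_single_edge n_gt0) expr4N expr1n. Qed.

End equality_cases.

Theorem theorem3p1 (R : realType) (n : nat) (hn : (2 <= n)%N) :
  let rho : R := (n./2)%:R in
  (forall G : sgraph n,
      ck R 4 G / (2 * rho) <= lambda R G 1 ^+ 4 /\
      lambda R G 1 ^+ 4 <= ck R 4 G / (1 + (n%:R - 1) ^- 3) /\
      8 * ck R 4 G + 6 * pos_part (ck R 2 G ^+ 2 - 2 * ck R 4 G) <= energy R G ^+ 4 /\
      (3 * ck R 2 G ^+ 2 - 2 * ck R 4 G) /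
        (n%:R * (n%:R - 1) * (n%:R ^+ 2 + 3 * n%:R - 6)) <= lambda R G n ^+ 4 /\
      lambda R G n ^+ 4 <= (4 * ck R 4 G - 3 * pos_part (2 * ck R 4 G - ck R 2 G ^+ 2)) / 8 /\
      beta R G ^+ 4 <= (3 * ck R 2 G ^+ 2 - 2 * ck R 4 G) / (12 * rho ^+ 2 - 4 * rho)) /\
  (forall G : sgraph n, bipartite G ->
      ck R 4 G / (2 * rho) <= lambda R G 1 ^+ 4 /\
      lambda R G 1 ^+ 4 <= (4 * ck R 4 G - 3 * pos_part (2 * ck R 4 G - ck R 2 G ^+ 2)) / 8 /\
      8 * ck R 4 G + 6 * pos_part (ck R 2 G ^+ 2 - 2 * ck R 4 G) <= energy R G ^+ 4 /\
      energy R G ^+ 4 <= 4 * rho ^+ 3 * (3 * ck R 2 G ^+ 2 - 2 * ck R 4 G) / (3 * rho - 1)) /\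
  (attained
      (fun G : sgraph n => ck R 4 G / (2 * rho))
      (fun G : sgraph n => lambda R G 1 ^+ 4) /\
   attained
      (fun G : sgraph n => lambda R G 1 ^+ 4)
      (fun G : sgraph n => ck R 4 G / (1 + (n%:R - 1) ^- 3)) /\
   attained
      (fun G : sgraph n => 8 * ck R 4 G + 6 * pos_part (ck R 2 G ^+ 2 - 2 * ck R 4 G))
      (fun G : sgraph n => energy R G ^+ 4) /\
   attained
      (fun G : sgraph n => (3 * ck R 2 G ^+ 2 - 2 * ck R 4 G) /
        (n%:R * (n%:R - 1) * (n%:R ^+ 2 + 3 * n%:R - 6)))
      (fun G : sgraph n => lambda R G n ^+ 4) /\
   attained
      (fun G : sgraph n => lambda R G n ^+ 4)
      (fun G : sgraph n => (4 * ck R 4 G - 3 * pos_part (2 * ck R 4 G - ck R 2 G ^+ 2)) / 8) /\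
   attained
      (fun G : sgraph n => beta R G ^+ 4)
      (fun G : sgraph n => (3 * ck R 2 G ^+ 2 - 2 * ck R 4 G) / (12 * rho ^+ 2 - 4 * rho))) /\
  (attained_bipartite
      (fun G : sgraph n => ck R 4 G / (2 * rho))
      (fun G : sgraph n => lambda R G 1 ^+ 4) /\
   attained_bipartite
      (fun G : sgraph n => lambda R G 1 ^+ 4)
      (fun G : sgraph n => (4 * ck R 4 G - 3 * pos_part (2 * ck R 4 G - ck R 2 G ^+ 2)) / 8) /\
   attained_bipartite
      (fun G : sgraph n => 8 * ck R 4 G + 6 * pos_part (ck R 2 G ^+ 2 - 2 * ck R 4 G))
      (fun G : sgraph n => energy R G ^+ 4) /\
   attained_bipartite
      (fun G : sgraph n => energy R G ^+ 4)
      (fun G : sgraph n => 4 * rho ^+ 3 * (3 * ck R 2 G ^+ 2 - 2 * ck R 4 G) / (3 * rho - 1))) /\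
  (forall (G : sgraph n) (r s : nat), (0 < r)%N -> (0 < s)%N -> (r + s)%N = n ->
      ereal_sup (ratios4 1 G (matching_graph n)) =
        (ck R 4 G / (2 * rho))%:E /\
      ereal_inf (ratios4 1 G (matching_graph n)) =
        ((3 * ck R 2 G ^+ 2 - 2 * ck R 4 G) / (12 * rho ^+ 2 - 4 * rho))%:E /\
      ereal_inf (ratios4 (n%:R - 1) G (complete_graph n)) =
        (ck R 4 G / (1 + (n%:R - 1) ^- 3))%:E /\
      ereal_sup (ratios4 1 G (complete_graph n)) =
        ((3 * ck R 2 G ^+ 2 - 2 * ck R 4 G) /
        (n%:R * (n%:R - 1) * (n%:R ^+ 2 + 3 * n%:R - 6)))%:E /\
      ereal_inf (ratios4 (Num.sqrt (r%:R * s%:R)) G (complete_bipartite r s)) =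
        ((4 * ck R 4 G - 3 * pos_part (2 * ck R 4 G - ck R 2 G ^+ 2)) / 8)%:E /\
      ereal_sup (ratios4 (2 * Num.sqrt (r%:R * s%:R)) G (complete_bipartite r s)) =
        (8 * ck R 4 G + 6 * pos_part (ck R 2 G ^+ 2 - 2 * ck R 4 G))%:E /\
      ereal_inf (ratios4 (2 * rho) G (matching_graph n)) =
        (4 * rho ^+ 3 * (3 * ck R 2 G ^+ 2 - 2 * ck R 4 G) / (3 * rho - 1))%:E).
Proof.
case: n hn => [//|m] m_gt0 rho.
split.
  move=> G; split; first exact: lam1_ge.
  split; first exact: lam1_le.
  split; first exact: energy_ge.
  split; first exact: lamn_ge.
  split; first exact: lamn_le.
  exact: beta_le.
split.
  move=> G bG; split; first exact: lam1_ge.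
  split; first exact: lam1_le_bipartite.
  split; first exact: energy_ge.
  exact: energy_le.
have bM := matching_graph_bipartite m.+1; have bE := single_edge_bipartite m.+1.
have eM := @matching_graph_edge m m_gt0; have eE := @single_edge_edge m m_gt0.
have eK := @complete_graph_edge m m_gt0.
split.
  split; first by exists (matching_graph m.+1); split; [|exact: matching_lam1].
  split; first by exists (complete_graph m.+1); split; [|exact: complete_lam1].
  split; first by exists (single_edge m.+1); split; [|exact: single_edge_energy].
  split; first by exists (complete_graph m.+1); split; [|exact: complete_lamn].
  split; first by exists (single_edge m.+1); split; [|exact: single_edge_lamn].
  by exists (matching_graph m.+1); split; [|exact: matching_beta].
split.
  split; first by exists (matching_graph m.+1); split; [| |exact: matching_lam1].
  split; first by exists (single_edge m.+1); split; [| |exact: single_edge_lam1].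
  split; first by exists (single_edge m.+1); split; [| |exact: single_edge_energy].
  by exists (matching_graph m.+1); split; [| |exact: matching_energy].
move=> G r s r_gt0 s_gt0 _.
split; first exact: sup_matching.
split; first exact: inf_matching.
split; first exact: inf_complete.
split; first exact: sup_complete.
split; first exact: inf_complete_bipartite.
split; first exact: sup_complete_bipartite.
exact: inf_scaled_matching.
Qed.
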